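(* Let $\gamma\in[1,2]$ and suppose that there are constants $c_0>\tilde c_0>0$ and $c_1>0$ such that for all $(x,t)\in Q_T$ $$\tilde c_0\, d^{\gamma}(x)\le a(x,t)\le c_0\, d^{\gamma}(x)\quad\text{and}\quad |\nabla a(x,t)|\le c_1\, d^{\gamma-1}(x).$$ Let $u\in C^{2,1}(Q_T)\cap C(\Omega\times[0,T])$ satisfy $\partial_t u=\operatorname{div}\{a(x,t)\nabla u\}$ in $Q_T$ and $u=0$ on $\Omega\times\{0\}$. Suppose moreover that, for some $C>0$, $\varepsilon_0>0$ and $\mu>-2\gamma+4$, $$\int_0^T\int_{\Omega^{\frac{\varepsilon}{2}}\setminus\Omega^{\frac{2}{3}\varepsilon}}|u(x,t)|\,[d(x)]^{\gamma-2}\,dx\,dt\le C\varepsilon^{\mu}\qquad\text{for every }\varepsilon\in(0,\varepsilon_0).$$ Then $u\equiv 0$ in $Q_T$.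
   Context: $\Omega\subset\mathbb{R}^n$ is an open bounded set whose boundary $\partial\Omega$ is a manifold of dimension $n-1$ of class $C^3$; $T>0$; $Q_T:=\Omega\times(0,T]$. The coefficient $a$ satisfies $a\in C^{1,0}_{x,t}(Q_T)$ ($C^1$ in $x$, continuous in $t$), $a\ge 0$, $a\not\equiv0$ in $Q_T$. $\nabla$ and $\operatorname{div}$ are taken with respect to $x$. $d(x):=\operatorname{dist}(x,\partial\Omega)$ for $x\in\Omega$, and $\Omega^{\varepsilon}:=\{x\in\Omega: d(x)>\varepsilon\}$ for $\varepsilon>0$. No boundary conditions are imposed on $\partial\Omega\times(0,T]$. *)

(* Defs.v *)
From HB Require Import structures.
From mathcomp Require Import all_boot all_order all_algebra.
From mathcomp Require Import all_classical all_reals all_analysis.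

Set Implicit Arguments.
Unset Strict Implicit.
Unset Printing Implicit Defensive.

Import Order.TTheory GRing.Theory Num.Theory.
Import numFieldNormedType.Exports.

Local Open Scope classical_set_scope.
Local Open Scope ring_scope.

(* The library norm on 'rV[R]_n is the sup norm; it is used only for topology
   and boundedness.  Lengths and distances use the Euclidean norm [enorm]. *)
Definition enorm (R : realType) (n : nat) (v : 'rV[R]_n) : R :=
  Num.sqrt (\sum_(i < n) v 0 i ^+ 2).

Definition boundary (T : topologicalType) (A : set T) : set T :=
  closure A `\` interior A.

Definition bdist (R : realType) (n : nat) (Omega : set 'rV[R]_n)
    (x : 'rV[R]_n) : R :=
  inf [set enorm (x - y) | y in boundary Omega].

Definition inner (R : realType) (n : nat) (Omega : set 'rV[R]_n) (eps : R) :
    set 'rV[R]_n :=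
  [set x | Omega x /\ eps < bdist Omega x].

Section Derivatives.
Context (R : realType) (n : nat).
Implicit Types (f : 'rV[R]_n -> R) (U : set 'rV[R]_n).

Definition evec (i : 'I_n) : 'rV[R]_n := delta_mx 0 i.

Definition partial (i : 'I_n) f (x : 'rV[R]_n) : R := 'D_(evec i) f x.

Definition grad f (x : 'rV[R]_n) : 'rV[R]_n := \row_i partial i f x.

Definition divergence (F : 'rV[R]_n -> 'rV[R]_n) (x : 'rV[R]_n) : R :=
  \sum_(i < n) partial i (fun y => F y 0 i) x.

(* Intended for open U. *)
Fixpoint Ck (k : nat) U f : Prop :=
  {within U, continuous f} /\
  if k is k'.+1 then
    forall i : 'I_n, (forall x, U x -> derivable f x (evec i)) /\
                     Ck k' U (partial i f)
  else True.

Definition Ck_map (k : nat) U (F : 'rV[R]_n -> 'rV[R]_n) : Prop :=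
  forall i : 'I_n, Ck k U (fun x => F x 0 i).

(* Embedded m-dimensional C^k submanifold of R^n: around each of its points, a
   C^k diffeomorphism phi : U -> V (with inverse psi) of open sets of R^n maps
   M onto the slice where the coordinates of index >= m vanish. *)
Definition submanifold (k m : nat) (M : set 'rV[R]_n) : Prop :=
  forall p, M p ->
    exists (U V : set 'rV[R]_n) (phi psi : 'rV[R]_n -> 'rV[R]_n),
      [/\ open U, open V & U p] /\
      [/\ forall x, U x -> V (phi x), forall y, V y -> U (psi y),
          {in U, cancel phi psi} & {in V, cancel psi phi}] /\
      [/\ Ck_map k U phi, Ck_map k V psi &
          forall x, U x ->
            (M x <-> forall i : 'I_n, (m <= i)%N -> phi x 0 i = 0)].

(* Functions of (x, t) on Q_T = Omega x (0, T]. *)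
Definition QT (Omega : set 'rV[R]_n) (T : R) : set ('rV[R]_n * R) :=
  Omega `*` `]0, T].

(* The difference quotient only uses times in (0, T]; at t = T the time
   derivative is the left derivative. *)
Definition time_quotient (T : R) (g : R -> R) (t : R) : set_system R :=
  (s - t)^-1 * (g s - g t) @[s --> within `]0, T] t^'].

Definition time_derivable (T : R) (g : R -> R) (t : R) : Prop :=
  cvg (time_quotient T g t).

Definition time_deriv (T : R) (g : R -> R) (t : R) : R :=
  lim (time_quotient T g t).

(* C^{1,0}_{x,t}(Q_T): g and its spatial gradient are jointly continuous. *)
Definition C10 (Omega : set 'rV[R]_n) (T : R) (g : 'rV[R]_n -> R -> R) : Prop :=
  {within QT Omega T, continuous (fun p : 'rV[R]_n * R => g p.1 p.2)} /\
  forall i : 'I_n,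
    (forall x t, QT Omega T (x, t) -> derivable (g ^~ t) x (evec i)) /\
    {within QT Omega T,
       continuous (fun p : 'rV[R]_n * R => partial i (g ^~ p.2) p.1)}.

Definition C21 (Omega : set 'rV[R]_n) (T : R) (g : 'rV[R]_n -> R -> R) : Prop :=
  [/\ C10 Omega T g,
      forall i : 'I_n, C10 Omega T (fun x t => partial i (g ^~ t) x),
      forall x t, QT Omega T (x, t) -> time_derivable T (g x) t &
      {within QT Omega T,
        continuous (fun p : 'rV[R]_n * R => time_deriv T (g p.1) p.2)}].

End Derivatives.

(* The library has no Lebesgue measure on R^n.  It is built here on
   n.-tuple R, with its product sigma-algebra, as the n-fold product of the
   Lebesgue measure of R. *)
Section LebesgueMeasureRn.
Context (R : realType).
Local Notation RR := (measurableTypeR R).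

Definition tcons (n : nat) (p : RR * n.-tuple RR) : n.+1.-tuple RR :=
  [the n.+1.-tuple RR of p.1 :: p.2].

Lemma measurable_tcons (n : nat) : measurable_fun setT (@tcons n).
Proof. by apply: measurable_cons. Qed.

Section Step.
Context (n : nat) (lambda : {sigma_finite_measure set RR -> \bar R})
  (mu : {sigma_finite_measure set (n.-tuple RR) -> \bar R}).

Definition leb_step : set (n.+1.-tuple RR) -> \bar R :=
  pushforward (lambda \x mu)%E (@tcons n).

Let mstep0 : leb_step set0 = 0%E.
Proof. by rewrite /leb_step /pushforward preimage_set0 measure0. Qed.

Let mstep_ge0 A : (0 <= leb_step A)%E.
Proof. by rewrite /leb_step /pushforward; exact: measure_ge0. Qed.

Let mstep_sigma_additive : semi_sigma_additive leb_step.
Proof.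
move=> F mF tF mUF; rewrite /leb_step /pushforward preimage_bigcup.
apply: measure_semi_sigma_additive.
- by move=> k; rewrite -[X in measurable X]setTI; exact: measurable_tcons.
- apply/trivIsetP => /= i j _ _ ij; rewrite -preimage_setI.
  by move/trivIsetP : tF => /(_ _ _ _ _ ij) ->//; rewrite preimage_set0.
- rewrite -preimage_bigcup -[X in measurable X]setTI.
  exact: measurable_tcons.
Qed.

HB.instance Definition _ := isMeasure.Build _ _ _ leb_step
  mstep0 mstep_ge0 mstep_sigma_additive.

Let mstep_sigma_finite : sigma_finite setT leb_step.
Proof.
have /sigma_finiteP[F [TF ndF Foo]] := sigma_finiteT lambda.
have /sigma_finiteP[G [TG ndG Goo]] := sigma_finiteT mu.
pose g (x : n.+1.-tuple RR) : RR * n.-tuple RR :=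
  (thead x, [tuple of behead x]).
have mg : measurable_fun setT g.
  apply/measurable_fun_pairP; split; first exact: measurable_tnth.
  exact: measurable_behead.
have gK : cancel (@tcons n) g.
  by case=> b s; congr pair; apply: val_inj.
exists (fun k => g @^-1` (F k `*` G k)).
  apply/esym; rewrite -subTset => x _.
  have [i _ Fi] : (\bigcup_i F i) (g x).1 by rewrite -TF.
  have [j _ Gj] : (\bigcup_i G i) (g x).2 by rewrite -TG.
  exists (maxn i j) => //; split.
  - by move: Fi; exact/subsetPset/ndF/leq_maxl.
  - by move: Gj; exact/subsetPset/ndG/leq_maxr.
move=> k; have [mF Fk] := Foo k; have [mG Gk] := Goo k.
have mFG : measurable (F k `*` G k) by exact: measurableX.
split; first by rewrite -[X in measurable X]setTI; exact: mg.
rewrite /leb_step /pushforward -comp_preimage.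
rewrite (_ : g \o _ = id); last by apply/funext => p /=; exact: gK.
by rewrite preimage_id product_measure1E// lte_mul_pinfty// ge0_fin_numE.
Qed.

HB.instance Definition _ := Measure_isSigmaFinite.Build _ _ _ leb_step
  mstep_sigma_finite.

End Step.

Definition leb0 : set (0.-tuple RR) -> \bar R := dirac [tuple].

HB.instance Definition _ := Measure.on leb0.

Let leb0_sigma_finite : sigma_finite setT leb0.
Proof.
exists (fun=> setT); first by rewrite bigcup_const.
by move=> _; split => //; rewrite /leb0 diracT ltry.
Qed.

HB.instance Definition _ := Measure_isSigmaFinite.Build _ _ _ leb0
  leb0_sigma_finite.

Fixpoint lebesgue_measure_n (n : nat) :
    {sigma_finite_measure set (n.-tuple RR) -> \bar R} :=
  if n is n'.+1 then leb_step lebesgue_measure (lebesgue_measure_n n')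
  else leb0.

Definition vec (n : nat) (x : n.-tuple RR) : 'rV[R]_n := \row_i tnth x i.

Definition integral_n (n : nat) (A : set 'rV[R]_n) (f : 'rV[R]_n -> \bar R) :
    \bar R :=
  (\int[lebesgue_measure_n n]_(x in @vec n @^-1` A) f (vec x))%E.

End LebesgueMeasureRn.

(* Main.v *)
Require Import Defs.
From HB Require Import structures.
From mathcomp Require Import all_boot all_order all_algebra.
From mathcomp Require Import all_classical all_reals all_analysis.
From mathcomp Require Import measurable_realfun.
From mathcomp Require Import ring lra.

(** Let [w = sabs u], where [sabs v = sqrt (1 + v^2) - 1] is smooth, convex,
    between 0 and [|v|], and vanishes only at 0.  Since [a >= 0], convexity
    turns the equation for [u] into [w_t <= div (a grad w)].  Let [eta] be a
    cutoff that is 1 where [d > 2 eps / 3] and 0 where [d <= eps / 2].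
    Multiplying by [eta] and integrating by parts twice over space gives

      d/dt (integral of eta w)  <=  integral of w L,
      L = div (a grad eta) = grad a . grad eta + a (Laplacian of eta).

    The function [L] lives on the strip [eps / 2 < d <= 2 eps / 3].  Derivatives
    of order [k] of [eta] are [O(eps^-k)], and [eps] is comparable to [d] on the
    strip, so the bounds on [a] and [grad a] give [|L| <= k d^(gamma - 2)] with
    [k] independent of [eps].  As [w <= |u|], the right-hand side is at most
    [k] times the integrand of the growth hypothesis.  Integrating from time 0,
    where [u] vanishes, yields

      (integral of eta w at time t)  <=  k C eps^mu,

    which tends to 0 with [eps] because [mu > 4 - 2 gamma >= 0].  If
    [u x t <> 0] at an interior point, then [eta w] stays above a positive
    constant on a fixed cube around [x] for all small [eps], a contradiction.

    The estimates of the weighted mass from above and below are [mass_le] and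
    [mass_ge].  They rest on three constructions.  [cutoff_exists] builds [eta]
    as a plateau function applied to a finite sum of [C^2] bumps centred at grid
    points of mesh [eps / (12 n)]; the derivative bounds come from counting the
    grid points that are close to a given point.  [integral_partial] says that
    a partial derivative of a compactly supported function integrates to 0; it
    is proved by induction on the dimension with Fubini.  [space_integral_FTC]
    is the fundamental theorem of calculus for integrals over space that depend
    on time. *)

Set Implicit Arguments.
Unset Strict Implicit.
Unset Printing Implicit Defensive.

Import Order.TTheory GRing.Theory Num.Theory.
Import numFieldNormedType.Exports.

Local Open Scope classical_set_scope.
Local Open Scope ring_scope.

(** * Measurability of continuous functions on tuples *)

Section RowVectors.
Context (R : realType) (n : nat).
Implicit Types (v : 'rV[R]_n).

Lemma rV_norm_le v e : 0 <= e -> (forall i, `|v 0 i| <= e) -> `|v| <= e.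
Proof.
move=> e0 ve; rewrite /Num.Def.normr/= mx_normrE; apply: bigmax_le => // -[i j] _ /=.
by rewrite ord1.
Qed.

Lemma rV_coord_le v i : `|v 0 i| <= `|v|.
Proof.
rewrite [leRHS]/Num.Def.normr/= mx_normrE.
by apply/bigmax_geP; right => /=; exists (0, i).
Qed.

End RowVectors.

Section MeasurableVec.
Context (R : realType) (n : nat).
Local Notation RR := (measurableTypeR R).

Let cell (k : nat) (x : n.-tuple RR) : {ffun 'I_n -> int} :=
  [ffun i => Num.floor (k.+1%:R * tnth x i)].

Let node (k : nat) (z : {ffun 'I_n -> int}) : 'rV[R]_n :=
  \row_i ((z i)%:~R / k.+1%:R).

Let measurable_cell k (Y : set {ffun 'I_n -> int}) : measurable (cell k @^-1` Y).
Proof.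
rewrite (_ : _ @^-1` _ = \bigcup_(z in Y) \bigcap_(i in [set: 'I_n])
    [set x | Num.floor (k.+1%:R * tnth x i) = z i]); last first.
  apply/seteqP; split => [x Yx|x [z Yz zx]]; rewrite /preimage/=.
    by exists (cell k x) => // i _ /=; rewrite ffunE.
  suff -> : cell k x = z by [].
  by apply/ffunP => i; rewrite ffunE; exact: zx.
rewrite bigcup_mkcond; apply: countable_bigcupT_measurable => [|z]; first exact: countableP.
case: ifPn => // _; apply: fin_bigcap_measurable => // i _.
rewrite (_ : [set x | _] = (fun x : n.-tuple RR => tnth x i) @^-1`
   `[(z i)%:~R / k.+1%:R, ((z i + 1)%:~R) / k.+1%:R[%classic); last first.
  apply/seteqP; split => x; rewrite /preimage/= in_itv/=.
    move=> <-; rewrite ler_pdivrMr// ltr_pdivlMr// mulrC.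
    by rewrite Num.Theory.floor_le/= floorD1_gt.
  rewrite ler_pdivrMr// ltr_pdivlMr// mulrC => zx.
  by apply: floor_def.
rewrite -[X in measurable X]setTI; apply: (measurable_tnth (T := RR) i) => //.
Qed.

(** The function is the pointwise limit of its values at the lower grid points of
    mesh [1 / (k + 1)], and these are constant on each of countably many cells,
    which are measurable. *)
Lemma measurable_continuous_vec (f : 'rV[R]_n -> R) : continuous f ->
  measurable_fun setT (fun x : n.-tuple RR => f (vec x)).
Proof.
move=> cf; apply/measurable_EFinP.
apply: (emeasurable_fun_cvg (fun k (x : n.-tuple RR) =>
  (f (node k (cell k x)))%:E)).
  move=> k; apply/measurable_EFinP => _ Y mY; rewrite setTI.
  exact: (measurable_cell k [set z | Y (f (node k z))]).
move=> x _; apply: cvg_EFin; first exact: nearW.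
apply: (@cvg_comp _ _ _ (fun k => node k (cell k x)) f _ (nbhs (vec x))); last exact: cf.
apply/cvgrPdist_le => e e0.
near=> k.
apply: rV_norm_le; first exact: ltW.
move=> i; rewrite !mxE ffunE; set y := tnth x i.
have -> : y - (Num.floor (k.+1%:R * y))%:~R / k.+1%:R =
  (k.+1%:R * y - (Num.floor (k.+1%:R * y))%:~R) / k.+1%:R :> R.
  by rewrite mulrBl mulrAC divff ?mul1r// pnatr_eq0.
rewrite ger0_norm; last by rewrite divr_ge0// subr_ge0 Num.Theory.floor_le.
apply: (@le_trans _ _ (k.+1%:R^-1)); last by near: k; apply: filterS (near_infty_natSinv_lt (PosNum e0)) => m /ltW.
rewrite ler_pdivrMr// mulVf ?pnatr_eq0// lerBlDr.
have := floorD1_gt (k.+1%:R * y); rewrite intrD addrC => /ltW; exact.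
Unshelve. all: by end_near. Qed.

End MeasurableVec.

(** * Integrating a partial derivative over space *)

Section AffineDerive.
Context (R : numFieldType) (U V W : normedModType R).

(** Restricting a function to a line or to a hyperplane is an affine change of
    variables, so its directional derivatives can be read off. *)
Lemma is_derive_affine (L : U -> V) (f : V -> W) (a v : U) (w : V) (df : W) :
  (forall h : R, L (h *: v + a) = h *: w + L a) ->
  is_derive (L a) w f df -> is_derive a v (f \o L) df.
Proof.
move=> Lh [d1 d2].
have E : (fun h : R => h^-1 *: ((f \o L) (h *: v + a) - (f \o L) a)) =
  (fun h : R => h^-1 *: (f (h *: w + L a) - f (L a))).
  by apply/funext => h; rewrite /comp Lh.
by split; [rewrite /derivable|rewrite /derive]; rewrite E.
Qed.

Lemma continuous_1lipschitz (L : U -> V) :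
  (forall x y, `|L x - L y| <= `|x - y|) -> continuous L.
Proof.
move=> LL x; apply/cvgrPdist_le => e e0; near=> y.
apply: le_trans (LL _ _) _; near: y.
have xx : id y @[y --> x] --> x by exact: cvg_id.
exact: (cvgr_dist_le _ _ xx).
Unshelve. all: by end_near. Qed.

End AffineDerive.

Section ConsVector.
Context (R : realType) (n : nat).
Local Notation RR := (measurableTypeR R).

(** The counterpart of [tcons] for row vectors. *)
Definition consv (x0 : R) (z : 'rV[R]_n) : 'rV[R]_n.+1 :=
  \row_i (if unlift ord0 i is Some j then z 0 j else x0).

Lemma consv0 x0 z : consv x0 z 0 ord0 = x0.
Proof. by rewrite mxE unlift_none. Qed.

Lemma consvS x0 z j : consv x0 z 0 (lift ord0 j) = z 0 j.
Proof. by rewrite mxE liftK. Qed.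

Lemma vec_tcons (p : RR * n.-tuple RR) : vec (tcons p) = consv p.1 (vec p.2).
Proof.
apply/rowP => i; rewrite !mxE; case: (unliftP ord0 i) => [j ->|->].
  by rewrite mxE tnthS.
by rewrite tnth0.
Qed.

Lemma consv_head (x0 h : R) (z : 'rV[R]_n) :
  consv (h *: 1 + x0) z = h *: evec R (ord0 : 'I_n.+1) + consv x0 z.
Proof.
apply/rowP => i; rewrite !mxE; case: (unliftP ord0 i) => [j ->|->] /=.
  by rewrite mulr0 add0r.
  by [].
Qed.

Lemma consv_tail (x0 h : R) (z : 'rV[R]_n) (j : 'I_n) :
  consv x0 (h *: evec R j + z) = h *: evec R (lift ord0 j) + consv x0 z.
Proof.
apply/rowP => i; rewrite !mxE; case: (unliftP ord0 i) => [k ->|->] /=.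
  by rewrite !mxE (inj_eq lift_inj).
by rewrite mulr0 add0r.
Qed.

Lemma consv_norm_head x0 z : `|x0| <= `|consv x0 z|.
Proof. by rewrite -[in leLHS](consv0 x0 z) rV_coord_le. Qed.

Lemma consv_norm_tail x0 z : `|z| <= `|consv x0 z|.
Proof. by apply: rV_norm_le => // j; rewrite -(consvS x0); exact: rV_coord_le. Qed.

Lemma consv_dist x0 y0 z w :
  `|consv x0 z - consv y0 w| <= Num.max `|x0 - y0| `|z - w|.
Proof.
apply: rV_norm_le; first by rewrite le_max normr_ge0.
move=> i; rewrite !mxE; case: (unliftP ord0 i) => [k _|_] /=.
  rewrite le_max; apply/orP; right.
  have -> : z 0 k - w 0 k = (z - w) 0 k by rewrite !mxE.
  exact: rV_coord_le.
by rewrite le_max lexx.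
Qed.

Lemma continuous_consv_tail x0 : continuous (consv x0).
Proof.
apply: (@continuous_1lipschitz _ 'rV[R]_n 'rV[R]_n.+1) => z w; apply: le_trans (consv_dist _ _ _ _) _.
by rewrite subrr normr0 ge_max normr_ge0 lexx.
Qed.

Lemma continuous_consv_head z : continuous (consv ^~ z).
Proof.
apply: (@continuous_1lipschitz _ R^o 'rV[R]_n.+1) => x y; apply: le_trans (consv_dist _ _ _ _) _.
by rewrite subrr normr0 ge_max normr_ge0 lexx.
Qed.

End ConsVector.

Section BoundedSupport.
Context d (X : measurableType d) (R : realType) (m : {measure set X -> \bar R}).

Lemma integrable_bounded_support (A : set X) (g : X -> R) B :
  measurable A -> (m A < +oo)%E -> measurable_fun setT g ->
  (forall x, `|g x| <= B) -> (forall x, ~ A x -> g x = 0) ->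
  m.-integrable setT (EFin \o g).
Proof.
move=> mA fA mg gB g0.
have -> : EFin \o g = (EFin \o g) \_ A.
  by apply/funext => x; rewrite patchE; case: ifPn => //; rewrite notin_setE => /g0 /= ->.
apply/(integrable_mkcond (EFin \o g) mA).
apply: measurable_bounded_integrable => //.
  exact: measurable_funS mg.
exists B; split; first exact: num_real.
by move=> y By x _ /=; rewrite (le_trans (gB x)) // ltW.
Qed.

End BoundedSupport.

Section CompactSupport.
Context (R : realType).
Local Notation RR := (measurableTypeR R).

Definition compact_support n (f : 'rV[R]_n -> R) : Prop :=
  continuous f /\ exists M : R, forall x, M < `|x| -> f x = 0.

Lemma compact_support_bounded n (f : 'rV[R]_n -> R) :
  compact_support f -> exists B : R, forall x, `|f x| <= B.
Proof.
move=> [cf [M fM]].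
pose K := [set x : 'rV[R]_n | `|x| <= M].
have cK : compact K.
  apply: bounded_closed_compact.
    exists M; split; first exact: num_real.
    by move=> y My x /= xM; rewrite (le_trans xM) ?ltW.
  rewrite (_ : K = (fun x : 'rV[R]_n => `|x|) @^-1` [set r | r <= M]); last by [].
  by apply: closed_comp => [x _|]; [exact: norm_continuous|exact: closed_le].
have : compact (f @` K).
  by apply: continuous_compact => //; exact: continuous_subspaceT.
move=> /compact_bounded [B [_ Bf]].
exists (Num.max 0 (B + 1)) => x; have [xM|Mx] := leP `|x| M.
  by rewrite le_max; apply/orP; right; apply: (Bf (B + 1)); [rewrite ltrDl|exists x].
by rewrite fM// normr0 le_max lexx.
Qed.

(** A closed cube: it contains the support of compactly supported functions, and
    serves to bound integrals from below. *)
Definition box n (c : 'I_n -> R) (r : R) : set (n.-tuple RR) :=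
  [set x | forall i, tnth x i \in `[c i - r, c i + r]].

Lemma measurable_box n (c : 'I_n -> R) r : measurable (box c r).
Proof.
rewrite (_ : box c r = \bigcap_(i in [set: 'I_n])
    (fun x : n.-tuple RR => tnth x i) @^-1` `[c i - r, c i + r]%classic).
  apply: fin_bigcap_measurable => // i _; rewrite -[X in measurable X]setTI.
  by apply: (measurable_tnth (T := RR) i).
by apply/seteqP; split => x /= xc i; [move=> _|]; apply: xc.
Qed.

Lemma lebesgue_measure_box n (c : 'I_n -> R) r : 0 <= r ->
  lebesgue_measure_n R n (box c r) = ((2 * r) ^+ n)%:E.
Proof.
move=> r0; elim: n c => [|n IHn] c.
  by rewrite /= /leb0 diracE mem_set// => -[].
have -> : lebesgue_measure_n R n.+1 (box c r) =
  (lebesgue_measure \x lebesgue_measure_n R n)%E (tcons (n := n) @^-1` box c r) by [].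
rewrite (_ : _ @^-1` _ = `[c ord0 - r, c ord0 + r]%classic `*`
    box (fun i => c (lift ord0 i)) r).
  rewrite product_measure1E//; last exact: measurable_box.
  rewrite IHn [X in (X * _)%E](_ : _ = (2 * r)%:E); last first.
    have [rp|rn] := ltP 0 r.
      rewrite /= lebesgue_measure_itv/= lte_fin ltrD2l gtrN// -EFinB.
      by congr EFin; ring.
    have -> : r = 0 by apply/eqP; rewrite eq_le rn r0.
    by rewrite /= lebesgue_measure_itv/= lte_fin subr0 addr0 ltxx mulr0.
  by rewrite -EFinM exprS.
apply/seteqP; split => -[x y]; rewrite /preimage/box/=.
  move=> H; split; first by have := H ord0; rewrite tnth0.
  by move=> i; have := H (lift ord0 i); rewrite tnthS.
move=> [H0 H1] i; case: (unliftP ord0 i) => [j ->|->]; last by rewrite tnth0.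
by rewrite tnthS.
Qed.

Lemma box_norm n (x : n.-tuple RR) r : 0 <= r ->
  box (fun=> 0) r x <-> `|vec x| <= r.
Proof.
move=> r0; split=> [xr|xr i].
  by apply: rV_norm_le => // i; rewrite mxE ler_norml; have := xr i; rewrite in_itv/= sub0r add0r.
have -> : tnth x i = vec x 0 i by rewrite mxE.
by rewrite in_itv/= sub0r add0r -ler_norml (le_trans _ xr)//; exact: rV_coord_le.
Qed.

Lemma integrable_compact_support n (f : 'rV[R]_n -> R) : compact_support f ->
  (lebesgue_measure_n R n).-integrable setT (fun x => (f (vec x))%:E).
Proof.
move=> cf; have [B fB] := compact_support_bounded cf.
have [ctf [M fM]] := cf.
apply: (@integrable_bounded_support _ _ _ _ (box (fun=> 0) `|M|) (fun x => f (vec x)) B).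
- exact: measurable_box.
- by have := @lebesgue_measure_box n (fun=> 0) `|M| (normr_ge0 _) => H; rewrite [ltLHS]H ltry.
- exact: measurable_continuous_vec.
- by move=> x; exact: fB.
- move=> x; rewrite box_norm// => /negP; rewrite -ltNge => Mx; apply: fM.
  exact: le_lt_trans (ler_norm _) Mx.
Qed.

(** This puts an integral over dimension [n + 1] in the form to which both orders
    of Fubini's theorem apply. *)
Lemma integral_tcons n (f : 'rV[R]_n.+1 -> R) : compact_support f ->
  let m := (lebesgue_measure \x lebesgue_measure_n R n)%E in
  let g (p : RR * n.-tuple RR) := (f (consv p.1 (vec p.2)))%:E in
  m.-integrable setT g /\
  (\int[lebesgue_measure_n R n.+1]_x (f (vec x))%:E = \int[m]_p g p)%E.
Proof.
move=> cf m g; have [B fB] := compact_support_bounded cf.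
have [ctf [M fM]] := cf.
have gE : g = (fun x => (f (vec x))%:E) \o (tcons (n := n)).
  by apply/funext => p; rewrite /g /= vec_tcons.
have mf := measurable_continuous_vec ctf.
have ig : m.-integrable setT g.
  apply: (@integrable_bounded_support _ _ _ _ (tcons (n:=n) @^-1` box (fun=> 0) `|M|)
    (fun p => f (consv p.1 (vec p.2))) B).
  - rewrite -[X in measurable X]setTI; apply: (measurable_tcons (n := n)) => //.
    exact: measurable_box.
  - have := @lebesgue_measure_box n.+1 (fun=> 0) `|M| (normr_ge0 _).
    by move=> /= H; rewrite [ltLHS]H ltry.
  - rewrite (_ : (fun p => _) = (fun x => f (vec x)) \o (tcons (n := n))); last first.
      by apply/funext => p; rewrite /= vec_tcons.
    exact: (measurableT_comp mf (measurable_tcons (n := n))).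
  - by move=> x; exact: fB.
  - move=> p; rewrite /preimage /= box_norm// => /negP; rewrite -ltNge => Mx.
    by rewrite -vec_tcons fM// (le_lt_trans (ler_norm _) Mx).
split => //.
have := @integral_pushforward _ _ _ _ R (tcons (n := n)) (measurable_tcons (n := n)) m setT
  (fun x => (f (vec x))%:E).
rewrite preimage_setT => H.
transitivity (\int[m]_p ((fun x => (f (vec x))%:E) \o (tcons (n := n))) p)%E.
  by apply: H => //; [exact/measurable_EFinP|rewrite -gE].
by apply: eq_integral => p _; rewrite -gE.
Qed.

Lemma integral_derive_compact_support (f g : R -> R) :
  continuous g -> (forall x : R, is_derive x 1 f (g x)) ->
  (exists M : R, forall x, M < `|x| -> f x = 0 /\ g x = 0) ->
  (\int[lebesgue_measure]_x (g x)%:E = 0)%E.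
Proof.
move=> cg fg [M fM]; pose N : R := `|M| + 1.
have Np : 0 < N by rewrite ltr_wpDl.
have N0 : - N < N by rewrite gtrN.
have MN : M < N by rewrite (le_lt_trans (ler_norm M))// ltrDl.
have fc : continuous f.
  by move=> x; apply: differentiable_continuous; apply/derivable1_diffP; have [] := fg x.
transitivity (\int[lebesgue_measure]_(x in `[(- N)%R, N]) (g x)%:E)%E.
  rewrite [RHS]integral_mkcond; apply: eq_integral => x _; rewrite patchE.
  case: ifPn => //; rewrite notin_setE/= in_itv/= => /negP; rewrite -ler_norml -ltNge => Nx.
  by rewrite (fM x (lt_trans MN Nx)).2.
rewrite (@continuous_FTC2 _ g f)//.
- by rewrite (fM N _).1 ?(fM (- N) _).1 ?subee// ?normrN ger0_norm// ltW.
- exact: continuous_subspaceT.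
- split; first by move=> x _; have [] := fg x.
  + by apply: cvg_at_right_filter; exact: fc.
  + by apply: cvg_at_left_filter; exact: fc.
- by move=> x _; rewrite derive1E; have [] := fg x.
Qed.

(** Integrate along the [i]-th axis first.  For the first axis the inner integral
    vanishes by the fundamental theorem of calculus; for another axis it is the
    induction hypothesis on the slices with fixed first coordinate. *)
Lemma integral_partial n (i : 'I_n) (f g : 'rV[R]_n -> R) :
  compact_support f -> compact_support g ->
  (forall x, is_derive x (evec R i) f (g x)) ->
  (\int[lebesgue_measure_n R n]_x (g (vec x))%:E = 0)%E.
Proof.
elim: n i f g => [[]//|n IHn] i f g cf cg fg.
have [ig ->] := integral_tcons cg.
have [ctf [M fM]] := cf; have [ctg [N gN]] := cg.
case: (unliftP ord0 i) fg => [j ->|->] fg.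
  rewrite -integral12_prod_meas1//.
  rewrite /fubini_F integral0_eq// => x0 _ /=.
  apply: (IHn j (f \o consv x0) (g \o consv x0)).
  - split; first by move=> z; apply: continuous_comp; [exact: continuous_consv_tail|exact: ctf].
    by exists M => z Mz; apply: fM; apply: lt_le_trans Mz (consv_norm_tail _ _).
  - split; first by move=> z; apply: continuous_comp; [exact: continuous_consv_tail|exact: ctg].
    by exists N => z Mz; apply: gN; apply: lt_le_trans Mz (consv_norm_tail _ _).
  - by move=> z; apply: is_derive_affine (fg _) => h; exact: consv_tail.
rewrite -integral21_prod_meas1//.
rewrite /fubini_G integral0_eq// => y _ /=.
pose cy x := consv x (vec y).
apply: (@integral_derive_compact_support (f \o cy) (g \o cy)).
- by move=> z; apply: continuous_comp; [exact: continuous_consv_head|exact: ctg].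
- by move=> z; apply: is_derive_affine (fg _) => h; exact: consv_head.
- exists (Num.max M N) => x; rewrite gt_max => /andP[Mx Nx].
  by split; [apply: fM|apply: gN]; apply: lt_le_trans (consv_norm_head _ _).
Qed.

End CompactSupport.

(** * Integrals depending on time *)

(** The integral of a nonnegative function is the supremum over the simple functions
    below it, so it is monotone whether or not the functions are measurable.
    This matters for the integral over the strip, taken at each time: its
    dependence on time is not known to be measurable. *)
Lemma le_integral_nonneg d (X : measurableType d) (R : realType)
    (m : {measure set X -> \bar R}) (f g : X -> \bar R) :
  (forall x, 0 <= f x)%E -> (forall x, f x <= g x)%E ->
  (\int[m]_x f x <= \int[m]_x g x)%E.
Proof.
move=> f0 fg; have g0 x : (0 <= g x)%E by exact: le_trans (f0 x) (fg x).
rewrite !ge0_integralTE//; apply: le_ereal_sup => _ [h hf <-].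
by exists h => // x; exact: le_trans (hf x) (fg x).
Qed.

Lemma within_continuous_comp (X Y Z : topologicalType) (A : set X) (B : set Y)
    (g : X -> Y) (f : Y -> Z) :
  {within A, continuous g} -> (forall x, A x -> B (g x)) ->
  {within B, continuous f} -> {within A, continuous (f \o g)}.
Proof.
move=> /subspace_continuousP cg AB /subspace_continuousP cf.
apply/subspace_continuousP => x Ax.
apply: (@cvg_comp _ _ _ g f _ (within B (nbhs (g x)))); last exact/cf/AB.
move=> P /= BP; have := cg x Ax _ BP; rewrite /nbhs/= /within/=.
have FF : Filter (nbhs x) by exact: nbhs_filter.
by apply: filterS => y gy Ay; exact: gy (AB _ Ay).
Qed.

Lemma continuous_pairl (X Y : topologicalType) (y : Y) :
  continuous (fun x : X => (x, y)).
Proof. by move=> x; apply: cvg_pair; [exact: cvg_id|exact: cvg_cst]. Qed.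

Lemma continuous_pairr (X Y : topologicalType) (x : X) :
  continuous (fun y : Y => (x, y)).
Proof. by move=> y; apply: cvg_pair; [exact: cvg_cst|exact: cvg_id]. Qed.

Section ZeroExtension.
Context (R : realType) (V : normedModType R).
Implicit Types (Omega K : set V) (f : V -> R).

(** The solution is only controlled inside [Omega], whereas integration needs
    functions on the whole space; products with a cutoff bridge the two. *)
Lemma continuous_zero_extension Omega K f : open Omega -> closed K ->
  K `<=` Omega -> {within Omega, continuous f} -> (forall x, ~ K x -> f x = 0) ->
  continuous f.
Proof.
move=> oO clK KO cf f0 x; have [Ox|nOx] := pselect (Omega x).
  by move: cf; rewrite continuous_open_subspace// => /(_ x); rewrite inE; exact.
have nKx : ~ K x by move=> /KO.
rewrite /continuous_at f0//.
have : nbhs x (~` K) by apply: open_nbhs_nbhs; split => //; exact: closed_openC.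
by move=> nK; apply: cvg_near_cst; apply: filterS nK => y /f0 ->.
Qed.

Lemma is_derive_zero_extension K f x v : closed K -> ~ K x ->
  (forall y, ~ K y -> f y = 0) -> is_derive x v f 0.
Proof.
move=> clK nKx f0.
have nK : nbhs x (~` K) by apply: open_nbhs_nbhs; split => //; exact: closed_openC.
apply: (@near_eq_is_derive _ _ _ (cst 0)).
by apply: filterS nK => y /f0 ->.
Qed.

End ZeroExtension.

Section ParametricIntegral.
Context (R : realType) (n : nat) (Omega K : set 'rV[R]_n).
Hypotheses (Omega_open : open Omega) (K_compact : compact K) (KOmega : K `<=` Omega).
Local Notation RR := (measurableTypeR R).
Local Notation mu := (lebesgue_measure_n R n).

Let K_closed : closed K.
Proof. by apply: compact_closed K_compact; exact: (@norm_hausdorff R 'rV[R]_n). Qed.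

Let K_bounded : exists M : R, forall x, K x -> `|x| <= M.
Proof.
have [M [_ KM]] := compact_bounded K_compact.
by exists (M + 1) => x Kx; apply: (KM (M + 1)) => //; rewrite ltrDl.
Qed.

Definition jointly_continuous (J : set R) (f : 'rV[R]_n -> R -> R) : Prop :=
  {within Omega `*` J, continuous (fun p : 'rV[R]_n * R => f p.1 p.2)}.

Lemma jointly_continuous_space J f t : jointly_continuous J f -> J t ->
  {within Omega, continuous (f ^~ t)}.
Proof.
move=> cf Jt.
apply: (within_continuous_comp (g := fun x => (x, t)) _ _ cf) => //.
by apply: continuous_subspaceT; exact: continuous_pairl.
Qed.

Lemma jointly_continuous_time J f x : jointly_continuous J f -> Omega x ->
  {within J, continuous (f x)}.
Proof.
move=> cf Ox.
apply: (within_continuous_comp (g := fun t => (x, t)) _ _ cf) => //.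
by apply: continuous_subspaceT; exact: continuous_pairr.
Qed.

Lemma compact_support_slice J f t : jointly_continuous J f ->
  (forall x, ~ K x -> f x t = 0) -> J t -> compact_support (f ^~ t).
Proof.
move=> cf f0 Jt; split.
  apply: (continuous_zero_extension Omega_open K_closed KOmega) => //.
  exact: jointly_continuous_space cf Jt.
have [M KM] := K_bounded; exists M => x Mx; apply: f0 => /KM.
by rewrite leNgt Mx.
Qed.

Lemma jointly_continuous_bounded J f s r : jointly_continuous J f ->
  (forall x t, ~ K x -> f x t = 0) -> `[s, r] `<=` J ->
  exists B : R, forall x t, t \in `[s, r] -> `|f x t| <= B.
Proof.
move=> cf f0 srJ.
have cKsr : compact (K `*` `[s, r]%classic).
  by apply: compact_setX => //; exact: segment_compact.
have : compact ((fun p : 'rV[R]_n * R => f p.1 p.2) @` (K `*` `[s, r]%classic)).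
  apply: continuous_compact => //; apply: continuous_subspaceW cf.
  by move=> [x t] [/= Kx srt]; split => /=; [exact: KOmega|exact: srJ].
move=> /compact_bounded [B [_ Bf]].
exists (Num.max 0 (B + 1)) => x t srt; have [Kx|nKx] := pselect (K x).
  rewrite le_max; apply/orP; right; apply: (Bf (B + 1)); first by rewrite ltrDl.
  by exists (x, t).
by rewrite f0// normr0 le_max lexx.
Qed.

Let dominating (B : R) : exists g : n.-tuple RR -> R,
  [/\ mu.-integrable setT (EFin \o g), forall x, 0 <= B -> 0 <= g x &
      forall x, K (vec x) -> g x = B].
Proof.
have [M KM] := K_bounded; pose A := box (fun _ : 'I_n => 0 : R) `|M|.
have mA : measurable A by exact: measurable_box.
exists (fun x => B * \1_A x); split.
- apply: (@integrable_bounded_support _ _ _ _ A _ `|B|) => //.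
  + by have := @lebesgue_measure_box R n (fun=> 0) `|M| (normr_ge0 _) => H; rewrite [ltLHS]H ltry.
  + by apply: measurable_funM => //; exact: measurable_indic.
  + move=> x; rewrite normrM ler_piMr// indicE; case: (_ \in _) => //=.
      by rewrite normr1. by rewrite normr0.
  + by move=> x nAx; rewrite indicE memNset// mulr0.
- by move=> x B0; rewrite mulr_ge0// indicE.
- move=> x Kx; rewrite indicE mem_set ?mulr1//; apply/box_norm => //.
  exact: le_trans (KM _ Kx) (ler_norm _).
Qed.

Definition space_integral (f : 'rV[R]_n -> R -> R) (t : R) : R :=
  (\int[mu]_x f (vec x) t)%R.

Lemma space_integral_continuous J f s r : jointly_continuous J f ->
  (forall x t, ~ K x -> f x t = 0) -> s <= r -> `[s, r] `<=` J ->
  {within `[s, r], continuous (space_integral f)}.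
Proof.
move=> cf f0 sr srJ.
have [B fB] := jointly_continuous_bounded cf f0 srJ.
(* Extending [f] in time by its values at [s] and [r] gives a function of all
   times, with the same bound. *)
pose clamp (t : R) := Num.max s (Num.min t r).
have clamp_in t : clamp t \in `[s, r].
  by rewrite in_itv/= le_max lexx/= ge_max sr/= ge_min lexx orbT.
have clamp_id t : t \in `[s, r] -> clamp t = t.
  by rewrite in_itv/= => /andP[st tr]; rewrite /clamp min_l// max_r.
have cclamp : continuous clamp.
  move=> t; apply: (@continuous_max R R (cst s) (fun t => Num.min t r)).
    exact: cvg_cst.
  by apply: (@continuous_min R R id (cst r)); [exact: cvg_id|exact: cvg_cst].
pose h (t : R) (x : n.-tuple RR) := f (vec x) (clamp t).
have [g [ig g0 gB]] := dominating B.
have B0 : 0 <= B by rewrite (le_trans _ (fB 0 s _))// in_itv/= lexx.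
have ch : continuous (fun t => \int[mu]_x h t x)%R.
  move=> t.
  apply: (@continuity_under_integral _ _ _ mu h setT measurableT (t - 1) (t + 1) _ _ g) => //.
  - move=> y _; apply: (@integrable_compact_support _ _ (f ^~ (clamp y))).
    by apply: compact_support_slice cf _ _; [move=> x; exact: f0|exact/srJ/clamp_in].
  - apply: aeW => x _ y _; suff cx : continuous (f (vec x) \o clamp) by exact: cx.
    have [Ox|nOx] := pselect (Omega (vec x)).
      apply/continuous_subspace_setT.
      apply: (within_continuous_comp (continuous_subspaceT cclamp)
        (fun t _ => srJ _ (clamp_in t))).
      exact: jointly_continuous_time cf Ox.
    rewrite (_ : _ \o _ = cst 0); first by move=> ?; exact: cvg_cst.
    by apply/funext => ? /=; apply: f0 => /KOmega.
  - move=> y _; apply: aeW => x _; have [Kx|nKx] := pselect (K (vec x)).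
      by rewrite gB//; exact: fB (clamp_in y).
    by rewrite /h f0// normr0 g0.
  - by rewrite inE/= in_itv/= ltrBlDr ltrDl ltr01/=.
apply: (@subspace_eq_continuous _ _ _ (fun t => \int[mu]_x h t x)%R).
  move=> t; rewrite inE => tsr; rewrite /space_integral /h; apply: eq_Rintegral => x _.
  by rewrite clamp_id.
exact: continuous_subspaceT.
Qed.

Section Derivative.
Context (T : R) (f df : 'rV[R]_n -> R -> R).
Hypotheses (cf : jointly_continuous `]0, T] f) (cdf : jointly_continuous `]0, T] df).
Hypotheses (f0 : forall x t, ~ K x -> f x t = 0) (df0 : forall x t, ~ K x -> df x t = 0).
Hypothesis fdf : forall x (t : R), t \in `]0, T[ -> is_derive t 1 (f x) (df x t).

Let sub_oc s r : 0 < s -> r < T -> `[s, r] `<=` `]0, T].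
Proof.
move=> s0 rT t; rewrite /= !in_itv/= => /andP[st tr].
by rewrite (lt_le_trans s0 st) (le_trans tr (ltW rT)).
Qed.

Lemma is_derive_space_integral (t : R) : t \in `]0, T[ ->
  is_derive t 1 (space_integral f) (space_integral df t).
Proof.
rewrite in_itv/= => /andP[t0 tT].
pose s := t / 2; pose r := (t + T) / 2.
have s0 : 0 < s by rewrite divr_gt0.
have st : s < t by rewrite /s; lra.
have tr : t < r by rewrite /r; lra.
have rT : r < T by rewrite /r; lra.
have srJ := sub_oc s0 rT.
have [B dfB] := jointly_continuous_bounded cdf df0 srJ.
have sr_in y : `]s, r[%classic y -> y \in `]0, T[.
  by rewrite /= !in_itv/= => /andP[sy yr]; rewrite (lt_trans s0 sy) (lt_trans yr rT).
have sr_in' y : `]s, r[%classic y -> `]0, T]%classic y.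
  by move=> /sr_in; rewrite /= !in_itv/= => /andP[-> /ltW].
have [g [ig g0 gB]] := dominating B.
have B0 : 0 <= B by rewrite (le_trans _ (dfB 0 s _))// in_itv/= lexx ltW ?(lt_trans st).
pose h (t : R) (x : n.-tuple RR) := f (vec x) t.
have It : `]s, r[%classic t by rewrite /= in_itv/= st tr.
have ih y : `]s, r[%classic y -> mu.-integrable setT (EFin \o h y).
  move=> /sr_in' yJ; apply: (@integrable_compact_support _ _ (f ^~ y)).
  by apply: compact_support_slice cf _ _; [move=> x; exact: f0|].
have d1h y x : `]s, r[%classic y -> partial1of2 h y x = df (vec x) y.
  by move=> /sr_in yT; rewrite partial1of2E; have [] := fdf (vec x) yT.
have dh y x : `]s, r[%classic y -> setT x -> derivable (h ^~ x) y 1.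
  by move=> /sr_in yT _; have [] := fdf (vec x) yT.
have hg y x : `]s, r[%classic y -> setT x -> `|partial1of2 h y x| <= g x.
  move=> yI _; rewrite d1h//; have [Kx|nKx] := pselect (K (vec x)).
    by rewrite gB//; apply: dfB; exact: subset_itv_oo_cc yI.
  by rewrite df0// normr0 g0.
have H1 := derivable_under_integral measurableT It ih dh (g0 ^~ B0) ig hg.
have H2 := differentiation_under_integral measurableT It ih dh (g0 ^~ B0) ig hg.
split; first exact: H1.
rewrite -derive1E; move: H2; rewrite /space_integral => ->.
by apply: eq_Rintegral => x _; rewrite d1h.
Qed.

Lemma space_integral_FTC (s r : R) : 0 < s -> s < r -> r < T ->
  (\int[lebesgue_measure]_(t in `[s, r]) (space_integral df t)%:E =
   (space_integral f r)%:E - (space_integral f s)%:E)%E.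
Proof.
move=> s0 sr rT; have srJ := sub_oc s0 rT.
have D t : t \in `[s, r] -> is_derive t 1 (space_integral f) (space_integral df t).
  rewrite in_itv/= => /andP[st tr]; apply: is_derive_space_integral.
  by rewrite in_itv/= (lt_le_trans s0 st) (le_lt_trans tr rT).
have C t : t \in `[s, r] -> {for t, continuous (space_integral f)}.
  move=> /D [dt _]; apply: differentiable_continuous; exact/derivable1_diffP.
apply: continuous_FTC2 => //.
- exact: space_integral_continuous cdf df0 (ltW sr) srJ.
- split.
  + by move=> t /subset_itv_oo_cc /D [].
  + by apply: cvg_at_right_filter; apply: C; rewrite in_itv/= lexx ltW.
  + by apply: cvg_at_left_filter; apply: C; rewrite in_itv/= lexx ltW.
- by move=> t /subset_itv_oo_cc /D [_ <-]; rewrite derive1E.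
Qed.

End Derivative.

End ParametricIntegral.

(** * The Euclidean norm and the distance to the boundary *)

Section EuclideanNorm.
Context (R : realType) (n : nat).
Implicit Types v w : 'rV[R]_n.

Lemma sum_sqr_ge0 v : 0 <= \sum_(i < n) v 0 i ^+ 2.
Proof. by apply: sumr_ge0 => i _; exact: sqr_ge0. Qed.

Lemma enorm_ge0 v : 0 <= enorm v.
Proof. exact: sqrtr_ge0. Qed.

Lemma sqr_enorm v : enorm v ^+ 2 = \sum_(i < n) v 0 i ^+ 2.
Proof. by rewrite sqr_sqrtr// sum_sqr_ge0. Qed.

Lemma coord_le_enorm v i : `|v 0 i| <= enorm v.
Proof.
rewrite -(ler_sqr (normr_ge0 _) (enorm_ge0 _)) sqr_enorm real_normK ?num_real//.
by rewrite (bigD1 i)//= lerDl; apply: sumr_ge0 => j _; exact: sqr_ge0.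
Qed.

Lemma norm_le_enorm v : `|v| <= enorm v.
Proof. by apply: rV_norm_le => [|i]; [exact: enorm_ge0|exact: coord_le_enorm]. Qed.

Lemma enorm_le_norm v : enorm v <= n%:R * `|v|.
Proof.
rewrite -(ler_sqr (enorm_ge0 _)) ?nnegrE ?mulr_ge0// sqr_enorm.
apply: (@le_trans _ _ (n%:R * `|v| ^+ 2)).
  rewrite mulr_natl -[X in _ *+ X](card_ord n) -sumr_const; apply: ler_sum => i _.
  by rewrite -(real_normK (num_real (v 0 i))) lerXn2r ?nnegrE//; exact: rV_coord_le.
rewrite exprMn ler_wpM2r ?sqr_ge0//.
case: (n) => [|m]; first by rewrite expr0n.
by rewrite expr2 ler_peMl// ler1n.
Qed.

Lemma enorm_eq0 v : enorm v = 0 -> v = 0.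
Proof.
move=> v0; apply/rowP => i; rewrite mxE; apply/eqP; rewrite -normr_le0 -v0.
exact: coord_le_enorm.
Qed.

Lemma enormN v : enorm (- v) = enorm v.
Proof. by rewrite /enorm; congr Num.sqrt; apply: eq_bigr => i _; rewrite mxE sqrrN. Qed.

Lemma enormZ (s : R) v : enorm (s *: v) = `|s| * enorm v.
Proof.
rewrite /enorm -sqrtr_sqr -sqrtrM ?sqr_ge0//; congr Num.sqrt.
by rewrite mulr_sumr; apply: eq_bigr => i _; rewrite mxE exprMn.
Qed.

(** The Cauchy-Schwarz inequality, from which the triangle inequality follows. *)
Lemma enorm_dot v w : \sum_(i < n) v 0 i * w 0 i <= enorm v * enorm w.
Proof.
set p := enorm v; set q := enorm w.
have [p0|p0] := eqVneq p 0.
  by rewrite big1 ?p0 ?mul0r// => i _; rewrite (enorm_eq0 p0) mxE mul0r.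
have [q0|q0] := eqVneq q 0.
  by rewrite big1 ?q0 ?mulr0// => i _; rewrite (enorm_eq0 q0) mxE mulr0.
have pp : 0 < p by rewrite lt_neqAle eq_sym p0 enorm_ge0.
have qp : 0 < q by rewrite lt_neqAle eq_sym q0 enorm_ge0.
have pq : 0 < 2 * p * q by rewrite !mulr_gt0.
(* Sum the inequalities [0 <= (q * v 0 i - p * w 0 i) ^+ 2]. *)
rewrite -(ler_pM2l pq).
have -> : 2 * p * q * (p * q) = q ^+ 2 * p ^+ 2 + p ^+ 2 * q ^+ 2 by ring.
rewrite [in X in _ <= _ * X + _]/p [in X in _ <= _ + _ * X]/q !sqr_enorm.
rewrite !mulr_sumr -big_split/=; apply: ler_sum => i _.
rewrite -!sqr_enorm -/p -/q -subr_ge0.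
rewrite (_ : _ - _ = (q * v 0 i - p * w 0 i) ^+ 2) ?sqr_ge0//; ring.
Qed.

Lemma enormD v w : enorm (v + w) <= enorm v + enorm w.
Proof.
rewrite -(ler_sqr (enorm_ge0 _)) ?nnegrE ?addr_ge0 ?enorm_ge0//.
have -> : enorm (v + w) ^+ 2 =
  enorm v ^+ 2 + 2 * (\sum_(i < n) v 0 i * w 0 i) + enorm w ^+ 2.
  rewrite !sqr_enorm mulr_sumr -!big_split/=; apply: eq_bigr => i _.
  by rewrite mxE; ring.
rewrite sqrrD lerD2r lerD2l -[leRHS]mulr_natl ler_wpM2l//; exact: enorm_dot.
Qed.

Lemma enormB v w : enorm (v - w) = enorm (w - v).
Proof. by rewrite -enormN opprB. Qed.

End EuclideanNorm.

Section BoundaryDistance.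
Context (R : realType) (n : nat) (Omega : set 'rV[R]_n).
Hypothesis Omega_open : open Omega.
Implicit Types x y z : 'rV[R]_n.

Let interior_open : interior Omega = Omega.
Proof. by apply/seteqP; split; [exact: interior_subset|rewrite -open_subsetE]. Qed.

Lemma boundary_notin z : boundary Omega z -> ~ Omega z.
Proof. by move=> [_]; rewrite interior_open. Qed.

(** Take the supremum of the parameters at which the segment is in [Omega]: the
    point there is adherent to [Omega], but not in it because [Omega] is open. *)
Lemma segment_boundary x y : Omega x -> ~ Omega y ->
  exists s : R, 0 <= s <= 1 /\ boundary Omega (s *: (y - x) + x).
Proof.
move=> Ox nOy; pose g (s : R) := s *: (y - x) + x.
pose S := [set s : R | 0 <= s <= 1 /\ Omega (g s)].
have S0 : S 0 by split; [rewrite lexx ler01|rewrite /g scale0r add0r].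
have ubS : ubound S 1 by move=> s [/andP[]].
have supS : has_sup S by split; [exists 0|exists 1].
have cg : continuous g.
  move=> s; apply: cvgD; last exact: cvg_cst.
  by apply: cvgZr_tmp; exact: cvg_id.
have s0 : 0 <= sup S by exact: ub_le_sup supS.2 _ S0.
have s1 : sup S <= 1 by exact: ge_sup supS.1 ubS.
exists (sup S); split; first by rewrite s0 s1.
have nO : ~ Omega (g (sup S)).
  move=> Og.
  have s1' : sup S < 1.
    rewrite lt_neqAle s1 andbT; apply/eqP => s1E; apply: nOy.
    by move: Og; rewrite s1E /g scale1r subrK.
  have : nbhs (sup S) (g @^-1` Omega).
    by apply: cg; exact: open_nbhs_nbhs.
  move=> /nbhs_ballP[e /= e0 eO].
  pose s := Num.min 1 (sup S + e / 2).
  have ss : sup S < s by rewrite lt_min s1' ltrDl divr_gt0.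
  suff : s <= sup S by rewrite leNgt ss.
  apply: ub_le_sup supS.2 _ _; split.
    by rewrite (le_trans s0 (ltW ss)) ge_min lexx.
  apply: eO; rewrite /ball/= distrC ger0_norm ?subr_ge0 ?ltW// ltrBlDl.
  apply: (@le_lt_trans _ _ (sup S + e / 2)); first by rewrite /s ge_min lexx orbT.
  by move: (sup S) e0 => w e0; lra.
split; last by rewrite interior_open.
move=> B Bg.
have : nbhs (sup S) (g @^-1` B) by exact: cg.
move=> /nbhs_ballP[e /= e0 eB].
have [s Ss es] := sup_adherent e0 supS.
exists (g s); split; first by case: Ss.
apply: eB; rewrite /ball/= ger0_norm ?subr_ge0; last exact: ub_le_sup supS.2 _ Ss.
by rewrite ltrBlDr -ltrBlDl.
Qed.

Let lb0 x : has_lbound [set enorm (x - y) | y in boundary Omega].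
Proof. by exists 0 => _ [y _ <-]; exact: enorm_ge0. Qed.

Lemma bdist_le x z : boundary Omega z -> bdist Omega x <= enorm (x - z).
Proof. by move=> Bz; apply: (ge_inf (lb0 x)); exists z. Qed.

(** Otherwise the segment from [x] to [y] would meet the boundary at a distance at
    most [enorm (y - x)] from [x]. *)
Lemma ball_bdist x y : Omega x -> enorm (y - x) < bdist Omega x -> Omega y.
Proof.
move=> Ox yx; apply: contrapT => nOy.
have [s [/andP[s0 s1] /(bdist_le x)]] := segment_boundary Ox nOy.
rewrite opprD addrCA subrr addr0 enormN enormZ ger0_norm//.
move=> xy; have := lt_le_trans yx xy; rewrite enormB ltNge => /negP; apply.
by rewrite ler_piMl// enorm_ge0.
Qed.

Lemma boundary_neq0 x : (0 < n)%N -> bounded_set Omega -> Omega x ->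
  exists z, boundary Omega z.
Proof.
move=> n0 [M [_ OM]] Ox.
suff [y nOy] : exists y, ~ Omega y.
  by have [s [_ Bz]] := segment_boundary Ox nOy; exists (s *: (y - x) + x).
pose i := Ordinal n0; exists (const_mx (`|M| + 2)) => /(OM (`|M| + 1)) /=.
rewrite (le_lt_trans (ler_norm M)) ?ltrDl// => /(_ isT).
apply/negP; rewrite -ltNge.
apply: lt_le_trans (rV_coord_le (const_mx (`|M| + 2)) i).
by rewrite mxE [ltRHS]ger0_norm ?addr_ge0//; lra.
Qed.

Hypothesis boundary_n0 : exists z, boundary Omega z.

Let B0 x : [set enorm (x - y) | y in boundary Omega] !=set0.
Proof. by have [z Bz] := boundary_n0; exists (enorm (x - z)); exists z. Qed.

Lemma bdist_ge x r : (forall z, boundary Omega z -> r <= enorm (x - z)) ->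
  r <= bdist Omega x.
Proof. by move=> H; apply: lb_le_inf => // _ [z Bz <-]; exact: H. Qed.

Lemma bdist_lipschitz x y : bdist Omega x <= bdist Omega y + enorm (x - y).
Proof.
rewrite -lerBlDr; apply: bdist_ge => z Bz; rewrite lerBlDr.
rewrite (le_trans (bdist_le x Bz))//.
have -> : x - z = (y - z) + (x - y) by rewrite [RHS]addrC addrA subrK.
exact: enormD.
Qed.

Lemma bdist_gt0 x : Omega x -> 0 < bdist Omega x.
Proof.
move=> Ox; have : nbhs x Omega by exact: open_nbhs_nbhs.
move=> /nbhs_ballP[e /= e0 eO]; apply: lt_le_trans e0 _; apply: bdist_ge => z Bz.
rewrite leNgt; apply/negP => xz; apply: (boundary_notin Bz); apply: eO.
rewrite -ball_normE /=; exact: le_lt_trans (norm_le_enorm _) xz.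
Qed.

(** A limit point of this set is adherent to [Omega] and at distance at least [e]
    from the boundary; not being a boundary point, it lies in [Omega]. *)
Lemma compact_bdist_ge (e : R) : bounded_set Omega -> 0 < e ->
  compact [set x | Omega x /\ e <= bdist Omega x].
Proof.
move=> bO e0; apply: bounded_closed_compact.
  have [M [Mr OM]] := bO; exists M; split => // r Mr' y [Oy _].
  exact: OM Oy.
move=> x xK.
have near_pt (r : R) : 0 < r -> exists2 y, Omega y /\ e <= bdist Omega y & `|x - y| < r.
  move=> r0; have [y [Ky]] := xK _ (nbhsx_ballx x r r0).
  by rewrite -ball_normE /=; exists y.
have ex : e <= bdist Omega x.
  apply/ler_addgt0Pr => r r0.
  have [|y [Oy ey] xy] := near_pt (r / n.+1%:R); first by rewrite divr_gt0.
  rewrite (le_trans ey)// (le_trans (bdist_lipschitz y x))// lerD2l.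
  rewrite enormB (le_trans (enorm_le_norm _))//.
  rewrite (@le_trans _ _ (n.+1%:R * `|x - y|))// ?ler_wpM2r ?ler_nat//.
  by rewrite mulrC -ler_pdivlMr// ltW.
split => //; apply: contrapT => nOx.
have Bx : boundary Omega x.
  split; last by rewrite interior_open.
  move=> B Bnx; have /nbhs_ballP[r /= r0 rB] := Bnx.
  have [y [Oy _] xy] := near_pt r r0; exists y; split => //; apply: rB.
  by rewrite -ball_normE.
have := bdist_le x Bx; rewrite subrr -[X in enorm X](scale0r 0) enormZ normr0 mul0r.
by rewrite leNgt (lt_le_trans e0 ex).
Qed.

End BoundaryDistance.

(** * Calculus along a direction, and powers of the positive part *)

Section DirectionalDerivative.
Context (R : realType) (V : normedModType R).

Lemma is_derive_lineP (f : V -> R) (x v : V) (df : R) :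
  is_derive x v f df <-> is_derive (0 : R) 1 (fun t : R => f (t *: v + x)) df.
Proof.
have E : (fun h : R => h^-1 *: (f (h *: v + x) - f x)) =
  (fun h : R => h^-1 *: (f ((h *: (1 : R) + 0 : R) *: v + x) - f ((0 : R) *: v + x))).
  by apply/funext => h; rewrite addr0 scale0r add0r -[h *: 1]/(h * 1) mulr1.
split=> -[d1 d2]; split.
- by move: d1; rewrite /derivable /= E.
- by move: d2; rewrite /derive /= E.
- by move: d1; rewrite /derivable /= -E.
- by move: d2; rewrite /derive /= -E.
Qed.

Lemma is_derive_chain (f : V -> R) (g : R -> R) (x v : V) (df dg : R) :
  is_derive x v f df -> is_derive (f x) 1 g dg ->
  is_derive x v (fun y => g (f y)) (dg * df).
Proof.
move=> /is_derive_lineP fl gf; apply/is_derive_lineP.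
have gf' : is_derive (f ((0 : R) *: v + x)) 1 g dg by rewrite scale0r add0r.
exact: (is_derive1_comp gf' fl).
Qed.

Lemma is_derive_invariant (f : V -> R) (x v : V) :
  (forall h : R, f (h *: v + x) = f x) -> is_derive x v f 0.
Proof.
move=> fx; apply/is_derive_lineP.
rewrite (_ : (fun t : R => _) = cst (f x)); first exact: is_derive_cst.
by apply/funext => t; exact: fx.
Qed.

Lemma is_derive_bigsum (I : Type) (s : seq I) (P : pred I) (f : I -> V -> R)
    (df : I -> R) (x v : V) :
  (forall i, is_derive x v (f i) (df i)) ->
  is_derive x v (fun y => \sum_(i <- s | P i) f i y) (\sum_(i <- s | P i) df i).
Proof.
move=> fdf; elim: s => [|i s IHs].
  rewrite big_nil (_ : (fun y => _) = cst 0); first exact: is_derive_cst.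
  by apply/funext => y; rewrite big_nil.
rewrite big_cons; case: ifPn => Pi.
  rewrite (_ : (fun y => _) = f i + (fun y => \sum_(i <- s | P i) f i y)).
    exact: is_deriveD.
  by apply/funext => y; rewrite big_cons Pi.
rewrite (_ : (fun y => _) = (fun y => \sum_(i <- s | P i) f i y))//.
by apply/funext => y; rewrite big_cons (negbTE Pi).
Qed.

Lemma is_derive_mul (f g : V -> R) (x v : V) (df dg : R) :
  is_derive x v f df -> is_derive x v g dg ->
  is_derive x v (fun y => f y * g y) (df * g x + f x * dg).
Proof.
move=> fd gd; have := is_deriveM fd gd => /= H; apply: is_derive_eq H _.
by rewrite addrC mulrC.
Qed.

Lemma is_derive_sub (f g : V -> R) (x v : V) (df dg : R) :
  is_derive x v f df -> is_derive x v g dg ->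
  is_derive x v (fun y => f y - g y) (df - dg).
Proof. exact: is_deriveB. Qed.

End DirectionalDerivative.

Section PositivePart.
Context (R : realType).

(** From the power 3 on, this function is of class [C^2]: it is the source of all
    the cutoffs below. *)
Definition ppow (k : nat) (s : R) : R := Num.max 0 s ^+ k.

Lemma ppow_ge0 k s : 0 <= ppow k s.
Proof. by rewrite exprn_ge0// le_max lexx. Qed.

Lemma ppow_le1 k s : s <= 1 -> ppow k s <= 1.
Proof. by move=> s1; rewrite exprn_ile1// ?le_max ?lexx// ge_max ler01. Qed.

Lemma ppow_neg k s : s <= 0 -> ppow k.+1 s = 0.
Proof. by move=> s0; rewrite /ppow max_l// expr0n. Qed.

Lemma continuous_ppow k : continuous (ppow k).
Proof.
move=> s.
apply: (@continuous_comp _ _ _ (cst (0 : R) \max id) (fun x : R => x ^+ k)).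
  by apply: (@continuous_max R R (cst 0) id); [exact: cvg_cst|exact: cvg_id].
exact: exprn_continuous.
Qed.

Lemma is_derive_ppow k (s : R) :
  is_derive s 1 (ppow k.+2) (k.+2%:R * ppow k.+1 s).
Proof.
have [s0|s0|->] := ltgtP s 0.
- rewrite ppow_neg ?ltW// mulr0.
  apply: (@near_eq_is_derive _ _ _ (cst 0)).
  have : nbhs s [set x | x < 0] by exact: lt_nbhsl.
  by apply: filterS => x x0; rewrite ppow_neg// ltW.
- have H : is_derive s 1 (fun x : R => x ^+ k.+2) (k.+2%:R * ppow k.+1 s).
    have H := @is_deriveX R R id k.+2 s 1 1 (is_derive_id s 1).
    rewrite (_ : (fun x : R => _) = id ^+ k.+2); last by rewrite exprfctE.
    apply: is_derive_eq H _; rewrite /ppow max_r ?ltW//.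
    by rewrite -[_ *: 1]/(_ * 1) mulr1.
  apply: near_eq_is_derive H.
  have : nbhs s [set x | 0 < x] by exact: lt_nbhsr.
  by apply: filterS => x x0; rewrite /ppow max_r// ltW.
- rewrite ppow_neg// mulr0.
  (* At 0 the difference quotient is at most [`|h| ^+ k.+1] in absolute value. *)
  have H : h^-1 *: (ppow k.+2 (h *: 1 + 0) - ppow k.+2 0) @[h --> (0 : R)^'] --> 0.
    apply/cvgrPdist_le => e e0.
    have : (0 : R)^' (ball 0 (Num.min 1 e)).
      by apply: nbhs_dnbhs; apply: nbhsx_ballx; rewrite lt_min ltr01.
    apply: filterS => h; rewrite /ball/= !sub0r normrN lt_min => /andP[h1 he].
    rewrite normrN addr0 (ppow_neg _ (lexx 0)) subr0 -[h *: 1]/(h * 1) mulr1.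
    rewrite -[_ *: _]/(_ * _) normrM normfV.
    have [->|hn0] := eqVneq h 0; first by rewrite normr0 invr0 mul0r ltW.
    rewrite ler_pdivrMl ?normr_gt0// ger0_norm ?ppow_ge0//.
    apply: (@le_trans _ _ (`|h| ^+ k.+2)).
      rewrite lerXn2r ?nnegrE ?le_max ?lexx//.
      by rewrite ge_max normr_ge0 ler_norm.
    rewrite exprS ler_wpM2l//.
    rewrite (@le_trans _ _ `|h|) ?(ltW he)//.
    by rewrite exprS ler_piMr// exprn_ile1// ltW.
  split; first by apply/cvg_ex; exists 0.
  exact: cvg_lim H.
Qed.

End PositivePart.

(** * A bump function on the line *)

Section Bump.
Context (R : realType).
Implicit Types s : R.

(** A piecewise polynomial bump of class [C^2] supported in [[-1, 1]], with its two
    first derivatives [spline1] and [spline2]. *)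
Definition spline s : R := ppow 3 (1 - s ^+ 2).
Definition spline1 s : R := - 6 * s * ppow 2 (1 - s ^+ 2).
Definition spline2 s : R := - 6 * ppow 2 (1 - s ^+ 2) + 24 * s ^+ 2 * ppow 1 (1 - s ^+ 2).

Let is_derive_sqr s : is_derive s 1 (fun s => 1 - s ^+ 2) (- 2 * s).
Proof.
have H1 := is_derive_mul (is_derive_id s 1) (is_derive_id s 1).
have H2 := is_deriveB (is_derive_cst (1 : R) s 1) H1.
rewrite (_ : (fun s => _) = cst 1 - (fun y : R => id y * id y)); last first.
  by apply/funext => y; rewrite expr2.
by apply: is_derive_eq H2 _ => /=; ring.
Qed.

Lemma is_derive_spline s : is_derive s 1 spline (spline1 s).
Proof.
have := is_derive_chain (is_derive_sqr s) (is_derive_ppow 1 (1 - s ^+ 2)).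
by move=> H; apply: is_derive_eq H _; rewrite /spline1; ring.
Qed.

Lemma is_derive_spline1 s : is_derive s 1 spline1 (spline2 s).
Proof.
have H1 := is_derive_chain (is_derive_sqr s) (is_derive_ppow 0 (1 - s ^+ 2)).
have H2 := is_derive_mul (is_derive_mul (is_derive_cst (- 6 : R) s 1) (is_derive_id s 1)) H1.
by apply: is_derive_eq H2 _ => /=; rewrite /spline2; ring.
Qed.

Lemma spline_ge0 s : 0 <= spline s. Proof. exact: ppow_ge0. Qed.

Let sqr_ge1 s : 1 <= `|s| -> 1 - s ^+ 2 <= 0.
Proof. by move=> s1; rewrite subr_le0 -(real_normK (num_real s)) exprn_ege1. Qed.

Lemma spline_out s : 1 <= `|s| -> [/\ spline s = 0, spline1 s = 0 & spline2 s = 0].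
Proof.
by move=> /sqr_ge1 s1; rewrite /spline /spline1 /spline2 !ppow_neg// !mulr0 addr0.
Qed.

Definition near_ind s : R := if `|s| < 1 then 1 else 0.

Lemma spline_bound s :
  [/\ `|spline s| <= near_ind s, `|spline1 s| <= 30 * near_ind s &
      `|spline2 s| <= 30 * near_ind s].
Proof.
rewrite /near_ind; have [s1|/spline_out[-> -> ->]] := ltP `|s| 1; last first.
  by rewrite normr0 mulr0.
rewrite mulr1.
have s2 : s ^+ 2 <= 1 by rewrite -(real_normK (num_real s)) exprn_ile1// ltW.
have q1 : 1 - s ^+ 2 <= 1 by rewrite lerBlDr lerDl sqr_ge0.
have p k : `|ppow k (1 - s ^+ 2)| <= 1 by rewrite ger0_norm ?ppow_ge0 ?ppow_le1.
split; first exact: p.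
- rewrite /spline1; move: (ppow 2 _) (p 2) => P HP.
  rewrite !normrM normrN (ger0_norm (ler0n _ 6)).
  apply: (@le_trans _ _ (6 * 1 * 1)); last by rewrite !mulr1 ler_nat.
  by rewrite !ler_pM// ?mulr_ge0// ltW.
- rewrite /spline2; move: (ppow 2 _) (p 2) (ppow 1 _) (p 1) => P HP Q HQ.
  apply: le_trans (ler_normD _ _) _; rewrite !normrM normrN.
  rewrite !(ger0_norm (ler0n _ _)).
  apply: (@le_trans _ _ (6 * 1 + 24 * 1 * 1)); last by rewrite !mulr1 -natrD.
  apply: lerD; first by rewrite ler_pM.
  by rewrite !ler_pM// ?mulr_ge0// -expr2 real_normK ?num_real.
Qed.

Lemma spline_center s : `|s| <= 2^-1 -> 27 / 64 <= spline s.
Proof.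
move=> s2; have H : 3 / 4 <= 1 - s ^+ 2.
  have : s ^+ 2 <= 2^-1 ^+ 2.
    by rewrite -(real_normK (num_real s)) lerXn2r ?nnegrE ?invr_ge0.
  by rewrite expr2; lra.
rewrite /spline /ppow max_r; last by rewrite (le_trans _ H)//; lra.
have -> : 27 / 64 = (3 / 4 : R) ^+ 3 by field.
by rewrite lerXn2r ?nnegrE//; lra.
Qed.

(** At most three integers are close to [y].  The summand is bounded by an increment
    of the bounded nondecreasing function [G], so the sum telescopes. *)
Lemma sum_near_ind (y : R) N : \sum_(k < N) near_ind (y - k%:R) <= 3.
Proof.
pose G (t : R) := Num.min 3 (Num.max 0 (t - y + 1)).
have G0 t : 0 <= G t by rewrite /G le_min le_max lexx ler0n.
have G3 t : G t <= 3 by rewrite /G ge_min lexx.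
suff : \sum_(k < N) near_ind (y - k%:R) <= G N%:R - G 0.
  by move=> /le_trans; apply; have := G0 0; have := G3 N%:R; lra.
elim: N => [|N IHN]; first by rewrite big_ord0 subrr.
rewrite big_ord_recr /=.
suff : near_ind (y - N%:R) <= G N.+1%:R - G N%:R by lra.
rewrite /near_ind /G -(natr1 N); move: (N%:R : R) => t.
case: (ltP `|y - t| 1) => [|_] /=.
  rewrite ltr_norml => /andP[h1 h2].
  rewrite max_r; last by lra. rewrite max_r; last by lra.
  rewrite min_r; last by lra. rewrite min_r; last by lra.
  by lra.
by rewrite subr_ge0 le_min2// le_max2//; lra.
Qed.

End Bump.

(** * Sums of bumps over a grid *)

Lemma continuous_is_derive (R : realType) (f df : R -> R) :
  (forall s : R, is_derive s 1 f (df s)) -> continuous f.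
Proof.
by move=> H s; apply: differentiable_continuous; apply/derivable1_diffP; have [] := H s.
Qed.

Lemma continuous_spline (R : realType) : continuous (@spline R).
Proof. exact: continuous_is_derive (@is_derive_spline R). Qed.

Lemma continuous_spline1 (R : realType) : continuous (@spline1 R).
Proof. exact: continuous_is_derive (@is_derive_spline1 R). Qed.

Lemma continuous_spline2 (R : realType) : continuous (@spline2 R).
Proof.
have c k : continuous (fun s : R => ppow k (1 - s ^+ 2)).
  move=> s; apply: (@continuous_comp _ _ _ (fun s : R => 1 - s ^+ 2) (ppow k)).
    by apply: cvgB; [exact: cvg_cst|exact: exprn_continuous].
  exact: continuous_ppow.
move=> s; rewrite /spline2; apply: cvgD.
  by apply: cvgM; [exact: cvg_cst|exact: c].
by apply: cvgM; [apply: cvgM; [exact: cvg_cst|exact: exprn_continuous]|exact: c].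
Qed.

Section ContinuousOperations.
Context (R : realType) (T : topologicalType).
Implicit Types f g : T -> R.

Lemma continuous_add f g : continuous f -> continuous g ->
  continuous (fun x => f x + g x).
Proof. by move=> cf cg x; apply: cvgD; [exact: cf|exact: cg]. Qed.

Lemma continuous_mul f g : continuous f -> continuous g ->
  continuous (fun x => f x * g x).
Proof. by move=> cf cg x; apply: cvgM; [exact: cf|exact: cg]. Qed.

Lemma continuous_fun_comp f (g : R -> R) : continuous g -> continuous f ->
  continuous (fun x => g (f x)).
Proof. by move=> cg cf x; apply: continuous_comp; [exact: cf|exact: cg]. Qed.

Lemma continuous_const (c : R) : continuous (fun _ : T => c).
Proof. by move=> x; exact: cvg_cst. Qed.

Lemma continuous_bigsum (I : Type) (s : seq I) (P : pred I) (f : I -> T -> R) :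
  (forall i, continuous (f i)) -> continuous (fun x => \sum_(i <- s | P i) f i x).
Proof.
by move=> cf x; apply: cvg_big => [|i _]; [exact: add_continuous|exact: cf].
Qed.

Lemma continuous_bigprod (I : Type) (s : seq I) (P : pred I) (f : I -> T -> R) :
  (forall i, continuous (f i)) -> continuous (fun x => \prod_(i <- s | P i) f i x).
Proof.
by move=> cf x; apply: cvg_big => [|i _]; [exact: mul_continuous|exact: cf].
Qed.

End ContinuousOperations.

Section GridSum.
Context (R : realType) (n N : nat) (L h : R) (S : pred {ffun 'I_n -> 'I_N}).
Hypothesis h_gt0 : 0 < h.
Implicit Types (k : {ffun 'I_n -> 'I_N}) (x : 'rV[R]_n).

Definition gridpt k : 'rV[R]_n := \row_j (h * (k j)%:R - L).

Definition gridz k x (j : 'I_n) : R := (x 0 j - gridpt k 0 j) / h.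

(** Differentiating [gridbump] along the axis [i] only affects the [i]-th factor of
    each product, so its two first derivatives along that axis are multiples of
    [gridsum g i] with [g] a derivative of [spline]. *)
Definition gridsum (g : R -> R) (i : 'I_n) x : R :=
  \sum_(k | S k) (g (gridz k x i) * \prod_(j | j != i) spline (gridz k x j)).

Definition gridbump x : R := \sum_(k | S k) \prod_j spline (gridz k x j).

Lemma gridbumpE i : gridbump = gridsum (@spline R) i.
Proof.
by apply/funext => x; apply: eq_bigr => k _; rewrite (bigD1 i).
Qed.

Lemma is_derive_gridsum (g dg : R -> R) (i : 'I_n) x :
  (forall s : R, is_derive s 1 g (dg s)) ->
  is_derive x (evec R i) (gridsum g i) (h^-1 * gridsum dg i x).
Proof.
move=> gd; rewrite /gridsum mulr_sumr.
apply: is_derive_bigsum => k.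
have dz : is_derive x (evec R i) (fun y => gridz k y i) h^-1.
  apply: (@is_derive_affine R 'rV[R]_n R R (fun y => gridz k y i) id _ _ h^-1).
  move=> t; rewrite /gridz !mxE !eqxx mulr1 -[_ *: _]/(_ * _).
  by rewrite -addrA mulrDl.
have dp : is_derive x (evec R i) (fun y => \prod_(j | j != i) spline (gridz k y j)) 0.
  apply: is_derive_invariant => t; apply: eq_bigr => j ji.
  by rewrite /gridz !mxE eqxx (negbTE ji)/= mulr0 add0r.
have := is_derive_mul (is_derive_chain dz (gd _)) dp.
by move=> H; apply: is_derive_eq H _; rewrite mulr0 addr0 mulrCA mulrA.
Qed.

Lemma continuous_gridz k j : continuous (fun x => gridz k x j).
Proof.
apply: continuous_mul; last exact: continuous_const.
by apply: continuous_add; [exact: coord_continuous|exact: continuous_const].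
Qed.

Lemma continuous_gridsum (g : R -> R) i : continuous g -> continuous (gridsum g i).
Proof.
move=> cg; apply: continuous_bigsum => k; apply: continuous_mul.
  by apply: continuous_fun_comp cg _; exact: continuous_gridz.
apply: continuous_bigprod => j.
by apply: continuous_fun_comp; [exact: continuous_spline|exact: continuous_gridz].
Qed.

(** Each term is dominated by the product over the coordinates of the indicators
    [near_ind].  Distributivity turns the sum of these products over the whole
    grid into a product of sums over the line, each at most 3. *)
Lemma gridsum_bound (g : R -> R) (B : R) i x : 0 <= B ->
  (forall s, `|g s| <= B * near_ind s) -> `|gridsum g i x| <= B * 3 ^+ n.
Proof.
move=> B0 gB; have q0 s : 0 <= near_ind s by rewrite /near_ind; case: ifP.
apply: (@le_trans _ _ (B * \sum_(k : {ffun 'I_n -> 'I_N}) \prod_j near_ind (gridz k x j))).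
  rewrite mulr_sumr (le_trans (ler_norm_sum _ _ _))//.
  rewrite [leRHS](bigID S)/= -[leLHS]addr0; apply: lerD; last first.
    by apply: sumr_ge0 => k _; rewrite mulr_ge0//; apply: prodr_ge0 => j _; exact: q0.
  apply: ler_sum => k _; rewrite normrM [X in _ <= B * X](bigD1 i)//= mulrA.
  apply: ler_pM => //; rewrite normr_prod.
  by apply: ler_prod => j _; rewrite normr_ge0/=; have [] := spline_bound (gridz k x j).
rewrite ler_wpM2l//.
pose q j (m : 'I_N) := near_ind ((x 0 j + L) / h - m%:R).
rewrite (eq_bigr (fun k : {ffun 'I_n -> 'I_N} => \prod_j q j (k j))); last first.
  move=> k _; apply: eq_bigr => j _; congr near_ind; rewrite /gridz mxE.
  by field; rewrite gt_eqF.
rewrite -bigA_distr_bigA/=.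
rewrite -[X in _ <= _ ^+ X]card_ord -prodr_const; apply: ler_prod => j _.
by apply/andP; split; [apply: sumr_ge0 => m _; exact: q0|exact: sum_near_ind].
Qed.

Lemma gridbump_ge0 x : 0 <= gridbump x.
Proof. by apply: sumr_ge0 => k _; apply: prodr_ge0 => j _; exact: spline_ge0. Qed.

Lemma gridsum_eq0 (g : R -> R) i x : (forall s, 1 <= `|s| -> g s = 0) ->
  (forall k, S k -> exists j, 1 <= `|gridz k x j|) -> gridsum g i x = 0.
Proof.
move=> g0 H; apply: big1 => k /H[j zj]; have [ji|ji] := eqVneq j i.
  by rewrite g0 ?mul0r// -ji.
by rewrite (bigD1 j)//=; have [-> _ _] := spline_out zj; rewrite mul0r mulr0.
Qed.

Lemma gridbump_lower x k : S k -> (forall j, `|gridz k x j| <= 2^-1) ->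
  (27 / 64) ^+ n <= gridbump x.
Proof.
move=> Sk xk; rewrite /gridbump (bigD1 k)//= -[leLHS]addr0; apply: lerD; last first.
  by apply: sumr_ge0 => *; apply: prodr_ge0 => j _; exact: spline_ge0.
rewrite -[X in _ ^+ X <= _]card_ord -prodr_const; apply: ler_prod => j _.
by rewrite divr_ge0//= spline_center.
Qed.

End GridSum.

(** * Cutoff functions *)

Section Plateau.
Context (R : realType) (c : R).
Hypothesis c_gt0 : 0 < c.

(** Applied to a sum of bumps that is at least [c] somewhere, this makes it exactly 1
    there while keeping two continuous derivatives. *)
Definition plateau (s : R) : R := 1 - ppow 3 (1 - s / c).
Definition plateau1 (s : R) : R := 3 / c * ppow 2 (1 - s / c).
Definition plateau2 (s : R) : R := - 6 / c ^+ 2 * ppow 1 (1 - s / c).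

Let is_derive_aff (s : R) : is_derive s 1 (fun s => 1 - s / c) (- c^-1).
Proof.
have H1 := is_derive_mul (is_derive_id s 1) (is_derive_cst (c^-1) s 1).
have H2 := is_deriveB (is_derive_cst (1 : R) s 1) H1.
by apply: is_derive_eq H2 _ => /=; ring.
Qed.

Lemma is_derive_plateau (s : R) : is_derive s 1 plateau (plateau1 s).
Proof.
have H1 := is_derive_chain (is_derive_aff s) (is_derive_ppow 1 (1 - s / c)).
have H2 := is_deriveB (is_derive_cst (1 : R) s 1) H1.
by apply: is_derive_eq H2 _; rewrite /plateau1; ring.
Qed.

Lemma is_derive_plateau1 (s : R) : is_derive s 1 plateau1 (plateau2 s).
Proof.
have H1 := is_derive_chain (is_derive_aff s) (is_derive_ppow 0 (1 - s / c)).
have H2 := is_derive_mul (is_derive_cst (3 / c) s 1) H1.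
by apply: is_derive_eq H2 _; rewrite /plateau2 /=; field; rewrite gt_eqF.
Qed.

Lemma continuous_plateau2 : continuous plateau2.
Proof.
apply: continuous_mul; first exact: continuous_const.
apply: continuous_fun_comp; first exact: continuous_ppow.
exact: continuous_is_derive is_derive_aff.
Qed.

Lemma plateau_0 : plateau 0 = 0.
Proof. by rewrite /plateau mul0r subr0 /ppow max_r// expr1n subrr. Qed.

Lemma plateau_ge s : c <= s -> [/\ plateau s = 1, plateau1 s = 0 & plateau2 s = 0].
Proof.
move=> cs; have H : 1 - s / c <= 0 by rewrite subr_le0 ler_pdivlMr// mul1r.
by rewrite /plateau /plateau1 /plateau2 !ppow_neg// subr0 !mulr0.
Qed.

Lemma plateau_bound s : 0 <= s ->
  [/\ 0 <= plateau s, `|plateau1 s| <= 3 / c & `|plateau2 s| <= 6 / c ^+ 2].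
Proof.
move=> s0; have H : 1 - s / c <= 1 by rewrite lerBlDr lerDl divr_ge0// ltW.
split.
- by rewrite subr_ge0 ppow_le1.
- rewrite normrM ger0_norm ?divr_ge0 ?(ltW c_gt0)//.
  by rewrite ler_piMr ?divr_ge0 ?(ltW c_gt0)// ger0_norm ?ppow_ge0 ?ppow_le1.
- rewrite normrM mulNr normrN [X in _ * X]ger0_norm ?ppow_ge0//.
  have c6 : 0 <= 6 / c ^+ 2 by rewrite divr_ge0 ?exprn_ge0 ?(ltW c_gt0).
  by rewrite ger0_norm// ler_piMr// ppow_le1.
Qed.

End Plateau.

Section Cutoff.
Context (R : realType) (n : nat) (Omega : set 'rV[R]_n).

(** Only the pure second derivatives [eta2 i] are recorded, because they are the only
    ones in [div (a grad eta)]. *)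
Definition cutoff (eps C : R) (eta : 'rV[R]_n -> R)
    (eta1 eta2 : 'I_n -> 'rV[R]_n -> R) : Prop :=
  [/\ continuous eta /\ (forall i, continuous (eta1 i) /\ continuous (eta2 i)),
      forall i x, is_derive x (evec R i) eta (eta1 i x) /\
                  is_derive x (evec R i) (eta1 i) (eta2 i x),
      forall x, 0 <= eta x,
      forall x, inner Omega (2 / 3 * eps) x ->
        eta x = 1 /\ forall i, eta1 i x = 0 /\ eta2 i x = 0 &
      forall x, ~ inner Omega (eps / 2) x ->
        eta x = 0 /\ forall i, eta1 i x = 0 /\ eta2 i x = 0] /\
  forall i x, `|eta1 i x| <= C / eps /\ `|eta2 i x| <= C / eps ^+ 2.

Hypotheses (n_gt0 : (0 < n)%N) (Omega_open : open Omega).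
Hypothesis Omega_bounded : bounded_set Omega.
Hypothesis boundary_n0 : exists z, boundary Omega z.

(** Sum the bumps of radius [h = eps / (12 n)] over the grid points where
    [d > 7 eps / 12].  A point within [h] of such a grid point in each coordinate
    is at Euclidean distance at most [eps / 12] from it, hence has [d > eps / 2].
    A point with [d > 2 eps / 3] is within [h / 2] of such a grid point in each
    coordinate, so that the sum is at least [c] there and the plateau function
    flattens it to 1. *)
Lemma cutoff_exists : exists C : R, 0 <= C /\ forall eps : R, 0 < eps ->
  exists eta eta1 eta2, cutoff eps C eta eta1 eta2.
Proof.
pose c : R := (27 / 64) ^+ n.
have c0 : 0 < c by rewrite exprn_gt0// divr_gt0.
have [M [_ OM]] := Omega_bounded; pose L := `|M| + 1.
have OL x : Omega x -> `|x| <= L.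
  by apply: OM; rewrite (le_lt_trans (ler_norm M))// ltrDl.
pose D : R := 30 * 3 ^+ n.
have D0 : 0 <= D by rewrite mulr_ge0// exprn_ge0.
have n0 : 0 < n%:R :> R by rewrite ltr0n.
pose C1 : R := 3 / c * (D * (12 * n%:R)).
pose C2 : R := (6 / c ^+ 2 * D ^+ 2 + 3 / c * D) * (12 * n%:R) ^+ 2.
have C10 : 0 <= C1 by rewrite !mulr_ge0 ?invr_ge0 ?(ltW c0) ?(ltW n0).
have C20 : 0 <= C2.
  by rewrite !(mulr_ge0, addr_ge0, exprn_ge0, invr_ge0) ?(ltW c0) ?(ltW n0).
exists (C1 + C2); split; first exact: addr_ge0.
move=> eps eps0; pose h := eps / (12 * n%:R).
have h0 : 0 < h by rewrite divr_gt0// mulr_gt0.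
(* The grid starts at [- L] in each coordinate; [N] steps of size [h] take it past [L]. *)
pose N := `|Num.ceil (2 * L / h + 2)|%N.
have L0 : 0 < L by rewrite ltr_wpDl.
have NL : 2 * L / h + 2 <= N%:R.
  rewrite /N natr_absz ger0_norm; last first.
    rewrite ceil_ge0 (lt_le_trans (ltrN10 R))//.
    by rewrite addr_ge0// divr_ge0// ?mulr_ge0// ltW.
  exact: ceil_ge.
pose pt (k : {ffun 'I_n -> 'I_N}) := gridpt L h k.
pose S (k : {ffun 'I_n -> 'I_N}) := `[< inner Omega (7 / 12 * eps) (pt k) >].
pose F := gridbump L h S.
pose F1 i x := h^-1 * gridsum L h S (@spline1 R) i x.
pose F2 i x := h^-1 * (h^-1 * gridsum L h S (@spline2 R) i x).
have F_ge0 x : 0 <= F x by exact: gridbump_ge0.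
have dF i x : is_derive x (evec R i) F (F1 i x).
  rewrite /F (gridbumpE _ _ _ i); apply: is_derive_gridsum => // s.
  exact: is_derive_spline.
have dF1 i x : is_derive x (evec R i) (F1 i) (F2 i x).
  have H0 : is_derive x (evec R i) (gridsum L h S (@spline1 R) i)
      (h^-1 * gridsum L h S (@spline2 R) i x).
    by apply: is_derive_gridsum => // s; exact: is_derive_spline1.
  have H := is_derive_mul (is_derive_cst h^-1 x (evec R i)) H0.
  by apply: is_derive_eq H _; rewrite mul0r add0r.
have cF : continuous F.
  by rewrite /F (gridbumpE _ _ _ (Ordinal n_gt0)); apply: continuous_gridsum; exact: continuous_spline.
have cF1 i : continuous (F1 i).
  apply: continuous_mul; first exact: continuous_const.
  by apply: continuous_gridsum; exact: continuous_spline1.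
have cF2 i : continuous (F2 i).
  do 2 (apply: continuous_mul; first exact: continuous_const).
  by apply: continuous_gridsum; exact: continuous_spline2.
have hE : h^-1 = 12 * n%:R / eps.
  by rewrite /h; field; rewrite !gt_eqF.
have h1_ge0 : 0 <= h^-1 by rewrite invr_ge0 ltW.
have F1b i x : `|F1 i x| <= D * (12 * n%:R) / eps.
  have -> : D * (12 * n%:R) / eps = h^-1 * D by rewrite hE; ring.
  rewrite normrM (ger0_norm h1_ge0) ler_wpM2l// gridsum_bound// => s.
  by have [] := spline_bound s.
have F2b i x : `|F2 i x| <= D * (12 * n%:R) ^+ 2 / eps ^+ 2.
  have -> : D * (12 * n%:R) ^+ 2 / eps ^+ 2 = h^-1 * (h^-1 * D).
    by rewrite hE; field; rewrite gt_eqF.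
  rewrite !normrM (ger0_norm h1_ge0) !ler_wpM2l// gridsum_bound// => s.
  by have [] := spline_bound s.
(* Outside [d > eps / 2], every selected grid point is at least [h] away from [x] in
   some coordinate, so all bumps and their derivatives vanish at [x]. *)
have Fout x : ~ inner Omega (eps / 2) x -> forall k, S k -> exists j, 1 <= `|gridz L h k x j|.
  move=> nx k /asboolP[Op dp]; apply: contrapT => nj; apply: nx.
  have xp : `|x - pt k| <= h.
    apply: rV_norm_le; first exact: ltW.
    move=> j; rewrite leNgt; apply/negP => hj; apply: nj; exists j.
    rewrite /gridz normrM normfV (gtr0_norm h0) ler_pdivlMr// mul1r.
    by have := ltW hj; rewrite [X in `|X|]mxE [X in `|_ + X|]mxE.
  have exp : enorm (x - pt k) <= eps / 12.
    rewrite (le_trans (enorm_le_norm _))// (@le_trans _ _ (n%:R * h))//.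
      by rewrite ler_wpM2l// ltW.
    by rewrite /h le_eqVlt; apply/orP; left; apply/eqP; field; rewrite gt_eqF.
  split.
    apply: (ball_bdist Omega_open Op); apply: le_lt_trans exp _; apply: lt_trans dp; lra.
  have := bdist_lipschitz boundary_n0 (pt k) x; rewrite enormB; lra.
have Fin x : inner Omega (2 / 3 * eps) x -> c <= F x.
  move=> [Ox dx].
  pose y j := (x 0 j + L) / h.
  have y0 j : 0 <= y j.
    rewrite divr_ge0 ?(ltW h0)//; have := rV_coord_le x j; rewrite ler_norml => /andP[+ _].
    by have := OL x Ox; lra.
  have yN j : y j <= 2 * L / h.
    rewrite ler_pM2r ?invr_gt0//; have := rV_coord_le x j; rewrite ler_norml => /andP[_].
    by have := OL x Ox; lra.
  (* [m j] indexes the grid coordinate closest to [x 0 j]. *)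
  pose m j := Num.floor (y j + 2^-1).
  have m0 j : 0 <= m j by rewrite floor_ge0 addr_ge0// invr_ge0.
  have m1 j : (m j)%:~R <= y j + 2^-1 by exact: Num.Theory.floor_le.
  have m2 j : y j + 2^-1 < (m j)%:~R + 1.
    by have := floorD1_gt (y j + 2^-1); rewrite intrD.
  have mE j : (`|m j|%N)%:R = (m j)%:~R :> R by rewrite natr_absz ger0_norm.
  have mN j : (`|m j| < N)%N.
    rewrite -(ltr_nat R) mE; apply: lt_le_trans NL; have := yN j; have := m1 j.
    by move: (2 * L / h) => w; lra.
  pose k : {ffun 'I_n -> 'I_N} := [ffun j => Ordinal (mN j)].
  have zk j : `|gridz L h k x j| <= 2^-1.
    have -> : gridz L h k x j = y j - (m j)%:~R.
      rewrite /gridz mxE ffunE /= mE /y; field; exact: lt0r_neq0.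
    by rewrite ler_norml; have := m1 j; have := m2 j; lra.
  apply: (@gridbump_lower R n N L h S x k) => //.
  have xp : `|x - pt k| <= h / 2.
    apply: rV_norm_le; first by rewrite divr_ge0// ltW.
    move=> j; have := zk j; rewrite /gridz normrM normfV (gtr0_norm h0) ler_pdivrMr// mulrC.
    by rewrite [X in _ -> `|X| <= _]mxE [X in _ -> `|_ + X| <= _]mxE.
  have exp : enorm (x - pt k) <= eps / 24.
    rewrite (le_trans (enorm_le_norm _))// (@le_trans _ _ (n%:R * (h / 2)))//.
      by rewrite ler_wpM2l// ltW.
    by rewrite /h le_eqVlt; apply/orP; left; apply/eqP; field; rewrite gt_eqF.
  apply/asboolP; split.
    apply: (ball_bdist Omega_open Ox); rewrite enormB.
    apply: le_lt_trans exp _; apply: lt_trans dx; lra.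
  have := bdist_lipschitz boundary_n0 x (pt k); lra.
exists (fun x => plateau c (F x)).
exists (fun i x => plateau1 c (F x) * F1 i x).
exists (fun i x => plateau2 c (F x) * F1 i x * F1 i x + plateau1 c (F x) * F2 i x).
split; first split.
- split.
    apply: continuous_fun_comp cF.
    exact: continuous_is_derive (@is_derive_plateau R c).
  have cp1 : continuous (fun x => plateau1 c (F x)).
    apply: continuous_fun_comp cF.
    exact: continuous_is_derive (is_derive_plateau1 c0).
  move=> i; split; first exact: continuous_mul.
  apply: continuous_add; last exact: continuous_mul.
  do 2 (apply: continuous_mul => //).
  exact: continuous_fun_comp (@continuous_plateau2 R c) cF.
- move=> i x; split; first exact: is_derive_chain (dF i x) (is_derive_plateau c (F x)).
  apply: is_derive_mul => //.
  exact: is_derive_chain (dF i x) (is_derive_plateau1 c0 (F x)).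
- by move=> x; have [] := plateau_bound c0 (F_ge0 x).
- move=> x /Fin /(plateau_ge c0)[-> -> ->]; split => // i.
  by rewrite !mul0r addr0.
- move=> x /Fout xout.
  have F0 : F x = 0.
    rewrite /F (gridbumpE _ _ _ (Ordinal n_gt0)); apply: gridsum_eq0 => //.
    by move=> s /spline_out[].
  rewrite F0 plateau_0; split => // i.
  have -> : F1 i x = 0.
    by rewrite /F1 gridsum_eq0 ?mulr0// => s /spline_out[].
  have -> : F2 i x = 0.
    by rewrite /F2 gridsum_eq0 ?mulr0// => s /spline_out[].
  by rewrite !mulr0 addr0.
move=> i x; have [_ p1 p2] := plateau_bound c0 (F_ge0 x); split.
  apply: (@le_trans _ _ (C1 / eps)).
    have -> : C1 / eps = 3 / c * (D * (12 * n%:R) / eps) by rewrite /C1; ring.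
    by rewrite normrM ler_pM.
  by rewrite ler_wpM2r ?invr_ge0 ?lerDl// ltW.
apply: (@le_trans _ _ (C2 / eps ^+ 2)); last first.
  by rewrite ler_wpM2r ?invr_ge0 ?exprn_ge0 ?lerDr// ltW.
have -> : C2 / eps ^+ 2 =
    6 / c ^+ 2 * (D * (12 * n%:R) / eps) * (D * (12 * n%:R) / eps) +
    3 / c * (D * (12 * n%:R) ^+ 2 / eps ^+ 2).
  by rewrite /C2; field; rewrite !gt_eqF.
apply: le_trans (ler_normD _ _) _.
move: (F1 i x) (F1b i x) (F2 i x) (F2b i x) => f1 f1b f2 f2b.
move: (plateau1 c _) p1 (plateau2 c _) p2 => q1 q1b q2 q2b; rewrite !normrM.
apply: lerD; last exact: ler_pM.
by apply: ler_pM => //; apply: ler_pM.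
Qed.

End Cutoff.

(** * A smooth convex substitute for the absolute value *)

Section SmoothAbs.
Context (R : realType).
Implicit Types v : R.

Let w v : R := Num.sqrt (1 + v ^+ 2).

Definition sabs v : R := w v - 1.
Definition sabs1 v : R := v / w v.
Definition sabs2 v : R := (w v ^+ 3)^-1.

Let w2_gt0 v : 0 < 1 + v ^+ 2.
Proof. by rewrite ltr_pwDl// sqr_ge0. Qed.

Let w_gt0 v : 0 < w v.
Proof. by rewrite sqrtr_gt0. Qed.

Let sqr_w v : w v ^+ 2 = 1 + v ^+ 2.
Proof. by rewrite sqr_sqrtr// ltW. Qed.

Let is_derive_w v : is_derive v 1 w (v / w v).
Proof.
have H1 := is_derive_mul (is_derive_id v 1) (is_derive_id v 1).
have H2 := is_deriveD (is_derive_cst (1 : R) v 1) H1.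
have H3 : is_derive v 1 (fun v => 1 + v ^+ 2) (2 * v).
  rewrite (_ : (fun v => _) = cst 1 + (fun y : R => id y * id y)); last first.
    by apply/funext => y; rewrite expr2.
  by apply: is_derive_eq H2 _ => /=; ring.
have := is_derive_chain H3 (is_derive1_sqrt (w2_gt0 v)).
by move=> H; apply: is_derive_eq H _; rewrite -/(w v); field; rewrite gt_eqF.
Qed.

Lemma is_derive_sabs v : is_derive v 1 sabs (sabs1 v).
Proof.
have H := is_deriveB (is_derive_w v) (is_derive_cst (1 : R) v 1).
by apply: is_derive_eq H _; rewrite subr0.
Qed.

Lemma is_derive_sabs1 v : is_derive v 1 sabs1 (sabs2 v).
Proof.
have wn0 : w v != 0 by rewrite gt_eqF.
have H := is_derive_mul (is_derive_id v 1) (is_deriveV wn0 (is_derive_w v)).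
apply: is_derive_eq H _; rewrite /= /sabs2 -[_ *: _]/(_ * _) mul1r.
apply: (@mulfI _ (w v ^+ 3)); first by rewrite expf_neq0.
rewrite divff ?expf_neq0//.
have -> : w v ^+ 3 * ((w v)^-1 + v * (- w v ^- 2 * (v / w v))) = w v ^+ 2 - v ^+ 2.
  by field.
by rewrite sqr_w addrK.
Qed.

Lemma sabs_ge0 v : 0 <= sabs v.
Proof.
rewrite subr_ge0 -(ler_sqr ler01) ?nnegrE ?(ltW (w_gt0 v))//.
by rewrite sqr_w expr1n lerDl sqr_ge0.
Qed.

Lemma sabs_le v : sabs v <= `|v|.
Proof.
rewrite lerBlDr -(ler_sqr (ltW (w_gt0 v))) ?nnegrE ?addr_ge0//.
rewrite sqr_w sqrrD real_normK ?num_real// mulr1 expr1n addrC -addrA lerD2l.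
by rewrite lerDr mulrn_wge0.
Qed.

Lemma sabs2_ge0 v : 0 <= sabs2 v.
Proof. by rewrite invr_ge0 exprn_ge0// ltW. Qed.

Lemma sabs0 : sabs 0 = 0.
Proof. by rewrite /sabs /w expr0n/= addr0 sqrtr1 subrr. Qed.

Lemma sabs_eq0 v : sabs v = 0 -> v = 0.
Proof.
move=> /eqP; rewrite subr_eq0 => /eqP w1; have := sqr_w v.
rewrite w1 expr1n => E; apply/eqP; rewrite -sqrf_eq0; apply/eqP; lra.
Qed.

Lemma continuous_sabs : continuous sabs.
Proof. exact: continuous_is_derive is_derive_sabs. Qed.

Lemma continuous_sabs1 : continuous sabs1.
Proof. exact: continuous_is_derive is_derive_sabs1. Qed.

Lemma continuous_sabs2 : continuous sabs2.
Proof.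
move=> v; apply: cvgV; first by rewrite expf_neq0// gt_eqF.
apply: (@continuous_comp _ _ _ w (fun x => x ^+ 3)); last exact: exprn_continuous.
exact: continuous_is_derive is_derive_w _.
Qed.

End SmoothAbs.

Section TimeDerivative.
Context (R : realType) (T : R).

(** Before the final time, the restriction of the difference quotients to times in
    [(0, T]] has no effect. *)
Lemma is_derive_time_deriv (g : R -> R) (t : R) : t \in `]0, T[ ->
  time_derivable T g t -> is_derive t 1 g (time_deriv T g t).
Proof.
move=> tT; rewrite /time_derivable /time_deriv; set l := lim _ => cl.
have H : h^-1 *: (g (h *: 1 + t) - g t) @[h --> (0 : R)^'] --> l.
  apply/cvgrPdist_le => e e0.
  have := cl; rewrite /time_quotient => /cvgrPdist_le /(_ e e0).
  rewrite /within/= => /nbhs_ballP[d /= d0 dl].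
  have : nbhs t (`]0, T]%classic).
    have : nbhs t (`]0, T[%classic) by apply: open_nbhs_nbhs; split => //; exact: interval_open.
    by apply: filterS => s; exact: subset_itv_oo_oc.
  move=> /nbhs_ballP[d' /= d'0 d'T].
  apply/nbhs_ballP; exists (Num.min d d'); rewrite /= ?lt_min ?d0//.
  move=> h; rewrite /ball/= sub0r normrN lt_min => /andP[hd hd'] h0.
  have := dl (h + t); rewrite /ball/= opprD addrCA subrr addr0 normrN => /(_ hd).
  have -> : h *: (1 : R) + t = h + t by rewrite -[h *: 1]/(h * 1) mulr1.
  rewrite addrK; apply.
    by apply/eqP => ht; move/eqP: h0; apply; apply: (addIr t); rewrite add0r.
  by apply: d'T; rewrite /ball/= opprD addrCA subrr addr0 normrN.
split; first by apply/cvg_ex; exists l.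
exact: cvg_lim H.
Qed.

End TimeDerivative.

(** * The energy estimate *)

Section JointlyContinuous.
Context (R : realType) (n : nat) (Omega : set 'rV[R]_n) (J : set R).
Local Notation jc := (@jointly_continuous R n Omega J).

Lemma jointly_continuousD f g : jc f -> jc g -> jc (fun x t => f x t + g x t).
Proof. exact: continuous_add. Qed.

Lemma jointly_continuousM f g : jc f -> jc g -> jc (fun x t => f x t * g x t).
Proof. exact: continuous_mul. Qed.

Lemma jointly_continuous_comp (g : R -> R) f : continuous g -> jc f ->
  jc (fun x t => g (f x t)).
Proof. exact: continuous_fun_comp. Qed.

Lemma jointly_continuous_cst (c : R) : jc (fun _ _ => c).
Proof. exact: continuous_const. Qed.

Lemma jointly_continuous_fst (g : 'rV[R]_n -> R) : continuous g -> jc (fun x _ => g x).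
Proof.
move=> cg; apply: continuous_subspaceT => p.
by apply: (@continuous_comp _ _ _ fst g); [exact: cvg_fst|exact: cg].
Qed.

Lemma jointly_continuous_sum (I : Type) (s : seq I) (f : I -> 'rV[R]_n -> R -> R) :
  (forall i, jc (f i)) -> jc (fun x t => \sum_(i <- s) f i x t).
Proof. by move=> cf; apply: continuous_bigsum. Qed.

End JointlyContinuous.

Section Energy.
Context (R : realType) (n : nat) (Omega : set 'rV[R]_n) (T : R).
Context (a u : 'rV[R]_n -> R -> R) (gamma c0 c1 : R).
Hypotheses (Omega_open : open Omega) (Omega_bounded : bounded_set Omega).
Hypothesis (boundary_n0 : exists z, boundary Omega z).
Hypothesis a_C10 : C10 Omega T a.
Hypothesis a_ge0 : forall x t, QT Omega T (x, t) -> 0 <= a x t.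
Hypotheses (c0_ge0 : 0 <= c0) (c1_ge0 : 0 <= c1).
Hypothesis a_le : forall x t, QT Omega T (x, t) -> a x t <= c0 * bdist Omega x `^ gamma.
Hypothesis grad_a_le : forall x t, QT Omega T (x, t) ->
  enorm (grad (a ^~ t) x) <= c1 * bdist Omega x `^ (gamma - 1).
Hypothesis u_C21 : C21 Omega T u.
Hypothesis u_C : {within Omega `*` `[0, T],
    continuous (fun p : 'rV[R]_n * R => u p.1 p.2)}.
Hypothesis u_eq : forall x t, QT Omega T (x, t) ->
    time_deriv T (u x) t = divergence (fun y => a y t *: grad (u ^~ t) y) x.
Hypothesis u_init : forall x, Omega x -> u x 0 = 0.

Local Notation J := (`]0, T]%classic).
Local Notation jc := (@jointly_continuous R n Omega J).
Local Notation mu := (lebesgue_measure_n R n).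

Let ai i x t := partial i (a ^~ t) x.
Let ui i x t := partial i (u ^~ t) x.
Let uii i x t := partial i (fun y => ui i y t) x.

Let ca : jc a. Proof. by case: a_C10. Qed.
Let cai i : jc (ai i). Proof. by case: a_C10 => _ /(_ i)[]. Qed.
Let cu : jc u. Proof. by case: u_C21 => -[]. Qed.
Let cui i : jc (ui i). Proof. by case: u_C21 => -[_ /(_ i)[]]. Qed.
Let cuii i : jc (uii i). Proof. by case: u_C21 => _ /(_ i)[_ /(_ i)[]]. Qed.
Let cut : jc (fun x t => time_deriv T (u x) t). Proof. by case: u_C21. Qed.

Let da i x t : Omega x -> J t -> is_derive x (evec R i) (a ^~ t) (ai i x t).
Proof. by move=> Ox Jt; apply: derivableP; case: a_C10 => _ /(_ i)[+ _]; apply. Qed.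

Let du i x t : Omega x -> J t -> is_derive x (evec R i) (u ^~ t) (ui i x t).
Proof. by move=> Ox Jt; apply: derivableP; case: u_C21 => -[_ /(_ i)[+ _]] _ _ _; apply. Qed.

Let dui i x t : Omega x -> J t ->
  is_derive x (evec R i) (fun y => ui i y t) (uii i x t).
Proof.
move=> Ox Jt; apply: derivableP.
by case: u_C21 => _ /(_ i)[_ /(_ i)[+ _]] _ _; apply.
Qed.

Let dut x t : Omega x -> t \in `]0, T[ -> is_derive t 1 (u x) (time_deriv T (u x) t).
Proof.
move=> Ox tT; apply: is_derive_time_deriv => //; case: u_C21 => _ _ + _; apply.
by split => //=; exact: subset_itv_oo_oc tT.
Qed.

Let equation x t : Omega x -> J t ->
  time_deriv T (u x) t = \sum_(i < n) (ai i x t * ui i x t + a x t * uii i x t).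
Proof.
move=> Ox Jt; rewrite u_eq//; apply: eq_bigr => i _; rewrite /partial.
rewrite (_ : (fun y => _) = (fun y => a y t * ui i y t)); last first.
  by apply/funext => y; rewrite !mxE.
by have [_ ->] := is_derive_mul (da i Ox Jt) (dui i Ox Jt).
Qed.

Section WithCutoff.
Context (eps C : R) (eta : 'rV[R]_n -> R) (eta1 eta2 : 'I_n -> 'rV[R]_n -> R).
Hypotheses (eps_gt0 : 0 < eps) (C_ge0 : 0 <= C).
Hypothesis eta_cutoff : cutoff Omega eps C eta eta1 eta2.

Let K := [set x | Omega x /\ eps / 2 <= bdist Omega x].

Let K_compact : compact K.
Proof. by apply: compact_bdist_ge => //; rewrite divr_gt0. Qed.

Let KO : K `<=` Omega. Proof. by move=> x []. Qed.

Let K_closed : closed K.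
Proof. by apply: compact_closed K_compact; exact: (@norm_hausdorff R 'rV[R]_n). Qed.

Let ceta : continuous eta. Proof. by case: eta_cutoff => -[[]]. Qed.
Let ceta1 i : continuous (eta1 i). Proof. by case: eta_cutoff => -[[_ /(_ i)[]]]. Qed.
Let ceta2 i : continuous (eta2 i). Proof. by case: eta_cutoff => -[[_ /(_ i)[]]]. Qed.
Let deta i x : is_derive x (evec R i) eta (eta1 i x).
Proof. by case: eta_cutoff => -[_ /(_ i x)[]]. Qed.
Let deta1 i x : is_derive x (evec R i) (eta1 i) (eta2 i x).
Proof. by case: eta_cutoff => -[_ /(_ i x)[]]. Qed.
Let eta_ge0 x : 0 <= eta x. Proof. by case: eta_cutoff => -[_ _ /(_ x)]. Qed.

Let eta_out x : ~ inner Omega (eps / 2) x ->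
  eta x = 0 /\ forall i, eta1 i x = 0 /\ eta2 i x = 0.
Proof. by case: eta_cutoff => -[_ _ _ _ /(_ x)]. Qed.

Let eta_in x : inner Omega (2 / 3 * eps) x ->
  eta x = 1 /\ forall i, eta1 i x = 0 /\ eta2 i x = 0.
Proof. by case: eta_cutoff => -[_ _ _ /(_ x)]. Qed.

Let etaK x : ~ K x -> eta x = 0 /\ forall i, eta1 i x = 0 /\ eta2 i x = 0.
Proof. by move=> nKx; apply: eta_out => -[Ox dx]; apply: nKx; split => //; exact: ltW. Qed.

(** This is [div (a grad eta)]. *)
Let L x t : R := \sum_(i < n) (ai i x t * eta1 i x + a x t * eta2 i x).

Let f x t : R := eta x * sabs (u x t).
Let df x t : R := eta x * (sabs1 (u x t) * time_deriv T (u x) t).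
Let flux i x t : R :=
  a x t * (eta x * (sabs1 (u x t) * ui i x t) - sabs (u x t) * eta1 i x).
(** The derivative of [flux i] along the axis [i]; the two terms with the product
    of first derivatives of [eta] and [u] have cancelled. *)
Let dflux i x t : R :=
  ai i x t * (eta x * (sabs1 (u x t) * ui i x t) - sabs (u x t) * eta1 i x) +
  a x t * (eta x * (sabs2 (u x t) * ui i x t * ui i x t + sabs1 (u x t) * uii i x t)
           - sabs (u x t) * eta2 i x).

Let cL : jc L.
Proof.
apply: jointly_continuous_sum => i; apply: jointly_continuousD; apply: jointly_continuousM => //;
  exact: jointly_continuous_fst.
Qed.

Let cabs : jc (fun x t => sabs (u x t)).
Proof. exact: jointly_continuous_comp (@continuous_sabs R) cu. Qed.
Let cabs1 : jc (fun x t => sabs1 (u x t)).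
Proof. exact: jointly_continuous_comp (@continuous_sabs1 R) cu. Qed.
Let cabs2 : jc (fun x t => sabs2 (u x t)).
Proof. exact: jointly_continuous_comp (@continuous_sabs2 R) cu. Qed.

Let copp g : jc g -> jc (fun x t => - g x t).
Proof. by apply: jointly_continuous_comp => x; apply: cvgN; exact: cvg_id. Qed.

Let cf : jc f.
Proof. by apply: jointly_continuousM => //; exact: jointly_continuous_fst. Qed.

Let cdf : jc df.
Proof.
apply: jointly_continuousM; first exact: jointly_continuous_fst.
exact: jointly_continuousM.
Qed.

Let cflux i : jc (flux i).
Proof.
apply: jointly_continuousM => //; apply: jointly_continuousD.
  by apply: jointly_continuousM; [exact: jointly_continuous_fst|exact: jointly_continuousM].
by apply: copp; apply: jointly_continuousM => //; exact: jointly_continuous_fst.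
Qed.

Let cdflux i : jc (dflux i).
Proof.
apply: jointly_continuousD; apply: jointly_continuousM => //; apply: jointly_continuousD.
- by apply: jointly_continuousM; [exact: jointly_continuous_fst|exact: jointly_continuousM].
- by apply: copp; apply: jointly_continuousM => //; exact: jointly_continuous_fst.
- apply: jointly_continuousM; first exact: jointly_continuous_fst.
  apply: jointly_continuousD; last exact: jointly_continuousM.
  by do 2 (apply: jointly_continuousM => //).
- by apply: copp; apply: jointly_continuousM => //; exact: jointly_continuous_fst.
Qed.

Let L0 x t : ~ K x -> L x t = 0.
Proof. by move=> /etaK[_ e12]; apply: big1 => i _; have [-> ->] := e12 i; rewrite !mulr0 addr0. Qed.

Let f0 x t : ~ K x -> f x t = 0.
Proof. by move=> /etaK[e _]; rewrite /f e mul0r. Qed.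

Let df0 x t : ~ K x -> df x t = 0.
Proof. by move=> /etaK[e _]; rewrite /df e mul0r. Qed.

Let flux0 i x t : ~ K x -> flux i x t = 0.
Proof. by move=> /etaK[e e12]; rewrite /flux e (e12 i).1 mul0r mulr0 subr0 mulr0. Qed.

Let dflux0 i x t : ~ K x -> dflux i x t = 0.
Proof.
by move=> /etaK[e e12]; rewrite /dflux e (e12 i).1 (e12 i).2 !mul0r !mulr0 subr0 !mulr0 addr0.
Qed.

Let is_derive_flux i x t : J t -> is_derive x (evec R i) (flux i ^~ t) (dflux i x t).
Proof.
move=> Jt; have [Kx|nKx] := pselect (K x); last first.
  by rewrite dflux0//; apply: is_derive_zero_extension K_closed nKx _ => y /flux0.
have Ox := KO Kx.
have H1 := is_derive_chain (du i Ox Jt) (is_derive_sabs (u x t)).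
have H2 := is_derive_chain (du i Ox Jt) (is_derive_sabs1 (u x t)).
have H3 := is_derive_mul (deta i x) (is_derive_mul H2 (dui i Ox Jt)).
have H4 := is_derive_mul H1 (deta1 i x).
have H5 := is_derive_mul (da i Ox Jt) (is_derive_sub H3 H4).
by apply: is_derive_eq H5 _; rewrite /dflux /=; ring.
Qed.

Let slice g t : jc g -> (forall x t, ~ K x -> g x t = 0) -> J t ->
  compact_support (g ^~ t).
Proof.
move=> cg g0; apply: (compact_support_slice Omega_open K_compact KO cg).
by move=> x; exact: g0.
Qed.

Let integral_dflux i t : J t -> (\int[mu]_x (dflux i (vec x) t)%:E = 0)%E.
Proof.
move=> Jt; apply: (@integral_partial R n i (flux i ^~ t) (dflux i ^~ t)).
- by apply: (slice (@cflux i)) => //; exact: flux0.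
- by apply: (slice (@cdflux i)) => //; exact: dflux0.
- by move=> x; exact: is_derive_flux.
Qed.

(** By the equation, the sum of the divergence terms is [df] plus a term that is
    nonnegative by convexity of [sabs], minus [sabs u] times [L]. *)
Let kato x t : J t -> df x t <= \sum_(i < n) dflux i x t + sabs (u x t) * `|L x t|.
Proof.
move=> Jt; have [Kx|nKx] := pselect (K x); last first.
  by rewrite df0// L0// normr0 mulr0 addr0 big1// => i _; rewrite dflux0.
have Ox := KO Kx.
have a0 : 0 <= a x t by apply: a_ge0; split.
have E : \sum_(i < n) dflux i x t = df x t
    + eta x * (sabs2 (u x t) * (a x t * \sum_(i < n) ui i x t ^+ 2)) - sabs (u x t) * L x t.
  rewrite /df equation// /L !mulr_sumr -!sumrN -!big_split/=.
  by apply: eq_bigr => i _; rewrite /dflux; ring.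
rewrite E -!addrA lerDl addr_ge0//.
  rewrite mulr_ge0// mulr_ge0 ?sabs2_ge0// mulr_ge0//.
  by apply: sumr_ge0 => i _; exact: sqr_ge0.
by rewrite addrC subr_ge0 ler_wpM2l ?sabs_ge0 ?ler_norm.
Qed.

(** The constant relating [|div (a grad eta)|] to [d^(gamma - 2)] on the strip.  It
    does not depend on [eps]; the added 1 makes it positive. *)
Definition strip_const : R := n%:R * ((c1 + c0) * C) + 1.

Lemma strip_const_gt0 : 0 < strip_const.
Proof. by rewrite ltr_wpDl// !mulr_ge0// addr_ge0. Qed.

Let strip := inner Omega (eps / 2) `\` inner Omega (2 / 3 * eps).

Let L_strip x t : ~ strip x -> L x t = 0.
Proof.
move=> nS; suff : forall i, eta1 i x = 0 /\ eta2 i x = 0.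
  by move=> e12; apply: big1 => i _; have [-> ->] := e12 i; rewrite !mulr0 addr0.
have [i1|/eta_out[]//] := pselect (inner Omega (eps / 2) x).
have [/eta_in[]//|i2] := pselect (inner Omega (2 / 3 * eps) x).
by exfalso; apply: nS; split.
Qed.

(** On the strip [d <= eps], so [C / eps <= C / d] and [C / eps^2 <= C / d^2]; both
    terms of [L] are then of order [d^(gamma - 2)]. *)
Let L_bound x t : J t -> strip x ->
  `|L x t| <= strip_const * bdist Omega x `^ (gamma - 2).
Proof.
move=> Jt [[Ox d1] nd2]; set d := bdist Omega x.
have d0 : 0 < d by exact: bdist_gt0.
have deps : d <= eps.
  have : d <= 2 / 3 * eps by rewrite leNgt; apply/negP => d2; apply: nd2.
  by move: eps_gt0; lra.
have eps1 : C / eps <= C / d by rewrite ler_wpM2l// lef_pV2.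
have eps2 : C / eps ^+ 2 <= C / d ^+ 2.
  by rewrite ler_wpM2l// lef_pV2 ?posrE ?exprn_gt0// lerXn2r// nnegrE ltW.
have p1 : d `^ (gamma - 1) = d `^ (gamma - 2) * d.
  rewrite -{3}(powRr1 (ltW d0)) -powRD; first by congr powR; ring.
  by rewrite (gt_eqF d0) implybT.
have p2 : d `^ gamma = d `^ (gamma - 2) * d ^+ 2.
  rewrite -powR_mulrn ?(ltW d0)// -powRD; first by congr powR; ring.
  by rewrite (gt_eqF d0) implybT.
have Q : QT Omega T (x, t) by split.
have bi i : `|ai i x t * eta1 i x + a x t * eta2 i x| <= (c1 + c0) * C * d `^ (gamma - 2).
  have [e1 e2] := eta_cutoff.2 i x.
  apply: le_trans (ler_normD _ _) _; rewrite !normrM.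
  have A1 : `|ai i x t| <= c1 * d `^ (gamma - 1).
    apply: le_trans (grad_a_le Q).
    have -> : ai i x t = grad (a ^~ t) x 0 i by rewrite mxE.
    exact: coord_le_enorm.
  have A2 : `|a x t| <= c0 * d `^ gamma by rewrite ger0_norm ?a_ge0 ?a_le.
  have -> : (c1 + c0) * C * d `^ (gamma - 2) =
      c1 * d `^ (gamma - 1) * (C / d) + c0 * d `^ gamma * (C / d ^+ 2).
    by rewrite p1 p2; field; rewrite gt_eqF.
  by apply: lerD; apply: ler_pM => //; apply: le_trans; eassumption.
apply: le_trans (ler_norm_sum _ _ _) _.
apply: (@le_trans _ _ (\sum_(i < n) (c1 + c0) * C * d `^ (gamma - 2))).
  by apply: ler_sum => i _.
rewrite sumr_const card_ord -[leLHS]mulr_natl mulrA ler_wpM2r ?powR_ge0//.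
by rewrite /strip_const lerDl.
Qed.

(** The weighted mass of the solution outside a neighbourhood of the boundary. *)
Definition mass (t : R) : R := space_integral (fun x t => eta x * sabs (u x t)) t.

Let h x t : R := sabs (u x t) * (`|L x t| / strip_const).

Let ch : jc h.
Proof.
apply: jointly_continuousM => //; apply: jointly_continuousM; last exact: jointly_continuous_cst.
by apply: jointly_continuous_comp cL => x; exact: norm_continuous.
Qed.

Let h0 x t : ~ K x -> h x t = 0.
Proof. by move=> nKx; rewrite /h L0// normr0 mul0r mulr0. Qed.

Let h_ge0 x t : 0 <= h x t.
Proof. by rewrite mulr_ge0 ?sabs_ge0// divr_ge0// ltW// strip_const_gt0. Qed.

Let integrable_jc g t : jc g -> (forall x t, ~ K x -> g x t = 0) -> J t ->
  mu.-integrable setT (EFin \o (fun x => g (vec x) t)).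
Proof.
move=> cg g0 Jt; apply: (@integrable_compact_support _ _ (g ^~ t)).
exact: slice cg g0 Jt.
Qed.

(** Integrate [kato] over space: the flux terms vanish. *)
Let mass_rate_le t : J t -> space_integral df t <= strip_const * space_integral h t.
Proof.
move=> Jt; have idf := integrable_jc (@cdf) df0 Jt.
have ih := integrable_jc (@ch) h0 Jt.
have isum : mu.-integrable setT (EFin \o (fun x => \sum_(i < n) dflux i (vec x) t)).
  apply: (integrable_jc (g := fun x t => \sum_(i < n) dflux i x t)) => //.
    exact: jointly_continuous_sum.
  by move=> x s nKx; apply: big1 => i _; exact: dflux0.
have ikh : mu.-integrable setT (EFin \o (fun x => strip_const * h (vec x) t)).
  apply: (integrable_jc (g := fun x t => strip_const * h x t)) => //.
    by apply: jointly_continuousM => //; exact: jointly_continuous_cst.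
  by move=> x s nKx; rewrite h0// mulr0.
have z : (\int[mu]_x \sum_(i < n) dflux i (vec x) t)%R = 0.
  rewrite /Rintegral; suff -> : (\int[mu]_x (\sum_(i < n) dflux i (vec x) t)%:E = 0)%E by [].
  transitivity (\int[mu]_x (\sum_(i < n) (dflux i (vec x) t)%:E))%E.
    by apply: eq_integral => x _; rewrite sumEFin.
  rewrite integral_sum//; first by apply: big1 => i _; exact: integral_dflux.
  by move=> i; apply: (integrable_jc (@cdflux i)) => //; exact: dflux0.
rewrite /space_integral -RintegralZl// -[leRHS]add0r -z -RintegralD//.
apply: le_Rintegral => //.
  have := integrableD measurableT isum ikh.
  by apply: eq_integrable.
move=> x _; apply: le_trans (kato _ Jt) _; rewrite lerD2l /h.
rewrite le_eqVlt; apply/orP; left; apply/eqP; field.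
by rewrite gt_eqF// strip_const_gt0.
Qed.

Let integral_h_le t : J t -> ((space_integral h t)%:E <=
  integral_n strip (fun x => (`|u x t| * bdist Omega x `^ (gamma - 2))%:E))%E.
Proof.
move=> Jt; have ih := integrable_jc (@ch) h0 Jt.
rewrite /space_integral /Rintegral fineK; last exact: integrable_fin_num.
rewrite /integral_n [leRHS]integral_mkcond; apply: le_integral_nonneg => x.
  by rewrite lee_fin.
rewrite patchE; case: ifPn => [|nS].
  rewrite inE => Sx; rewrite lee_fin /h ler_pM ?sabs_ge0 ?sabs_le//.
    by rewrite divr_ge0// ltW// strip_const_gt0.
  by rewrite ler_pdivrMr ?strip_const_gt0// mulrC L_bound.
rewrite /h L_strip ?normr0 ?mul0r ?mulr0//.
by move=> Sx; move/negP: nS; apply; rewrite inE.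
Qed.

Let dmass x t : t \in `]0, T[ -> is_derive t 1 (f x) (df x t).
Proof.
move=> tT; have [Kx|nKx] := pselect (K x); last first.
  rewrite df0// (_ : f x = cst 0); first exact: is_derive_cst.
  by apply/funext => s; rewrite f0.
have H1 := is_derive_chain (dut (KO Kx) tT) (is_derive_sabs (u x t)).
have H2 := is_derive_mul (is_derive_cst (eta x) t 1) H1.
by apply: is_derive_eq H2 _; rewrite mul0r add0r.
Qed.

(** On the cube around [x0] the cutoff is 1 and the integrand is at least [v]. *)
Lemma mass_ge (t : R) (x0 : 'rV[R]_n) (r v : R) : J t -> 0 <= v -> 0 < r ->
  (forall x, `|x - x0| <= r -> inner Omega (2 / 3 * eps) x /\ v <= sabs (u x t)) ->
  v * (2 * r) ^+ n <= mass t.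
Proof.
move=> Jt v0 r0 near_x0; have iF := integrable_jc (@cf) f0 Jt.
rewrite -lee_fin /mass /space_integral /Rintegral fineK; last exact: integrable_fin_num.
rewrite EFinM -(lebesgue_measure_box (x0 0) (ltW r0)).
have mb := @measurable_box R n (x0 0) r.
rewrite -[X in (_ * mu X)%E]setIT -(integral_indic mu measurableT mb).
rewrite -ge0_integralZl_EFin//; last exact/measurable_EFinP/measurable_indic.
apply: le_integral_nonneg => x; first by rewrite mule_ge0// lee_fin.
rewrite -EFinM lee_fin indicE; case: (boolP (x \in _)) => [|_]; last first.
  by rewrite mulr0 mulr_ge0// sabs_ge0.
rewrite inE => xb; rewrite mulr1.
have [|xin vu] := near_x0 (vec x).
  apply: rV_norm_le => [|i]; first exact: ltW.
  rewrite !mxE; have := xb i; rewrite in_itv/= => /andP[x1 x2].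
  by rewrite ler_norml; lra.
by have [-> _] := eta_in xin; rewrite mul1r.
Qed.

Context (B : R).
Hypothesis strip_integral_le :
  (\int[lebesgue_measure]_(t in `[0%R, T])
     integral_n (inner Omega (eps / 2) `\` inner Omega (2 / 3 * eps))
       (fun x => (`|u x t| * bdist Omega x `^ (gamma - 2))%:E) <= B%:E)%E.

Let mass_increment s r : 0 < s -> s < r -> r < T ->
  mass r <= mass s + strip_const * B.
Proof.
move=> s0 sr rT.
have srJ : `[s, r] `<=` J.
  move=> t; rewrite /= !in_itv/= => /andP[st tr].
  by rewrite (lt_le_trans s0 st) (le_trans tr (ltW rT)).
have FTC := space_integral_FTC Omega_open K_compact KO (@cf) (@cdf) f0 df0 dmass s0 sr rT.
have cI g : jc g -> (forall x t, ~ K x -> g x t = 0) ->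
    lebesgue_measure.-integrable `[s, r] (EFin \o space_integral g).
  move=> cg g0; apply: continuous_compact_integrable; first exact: segment_compact.
  exact: (space_integral_continuous Omega_open K_compact KO cg g0 (ltW sr) srJ).
have hB : (\int[lebesgue_measure]_(t in `[s, r]) (space_integral h t)%:E <= B%:E)%E.
  apply: le_trans strip_integral_le.
  rewrite integral_mkcond [leRHS]integral_mkcond; apply: le_integral_nonneg => t.
    rewrite patchE; case: ifP => // _; rewrite lee_fin.
    by apply: Rintegral_ge0 => x _.
  rewrite !patchE; case: ifPn => [|_].
    rewrite inE => tsr; have tJ := srJ _ tsr.
    by rewrite ifT; [exact: integral_h_le|rewrite inE; exact: subset_itv_oc_cc tJ].
  case: ifP => // _; apply: integral_ge0 => x _.
  by rewrite lee_fin mulr_ge0// powR_ge0.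
have H : (\int[lebesgue_measure]_(t in `[s, r]) (space_integral df t)%:E <=
    (strip_const * B)%:E)%E.
  apply: (@le_trans _ _ (\int[lebesgue_measure]_(t in `[s, r])
      (strip_const%:E * (space_integral h t)%:E))%E).
    apply: le_integral => //.
    - exact: cI (@cdf) df0.
    - by apply: integrableZl => //; exact: cI (@ch) h0.
    - by move=> t; rewrite inE => /srJ Jt; rewrite lee_fin mass_rate_le.
  rewrite integralZl//; last exact: cI (@ch) h0.
  by rewrite EFinM lee_pmul2l// lte_fin strip_const_gt0.
by move: H; rewrite FTC -EFinB lee_fin lerBlDl.
Qed.

(** Let the initial time in [mass_increment] tend to 0: the mass is continuous up to
    time 0, where it vanishes. *)
Lemma mass_le (r : R) : 0 < r -> r < T -> mass r <= strip_const * B.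
Proof.
move=> r0 rT.
have c0r : {within `[0, r], continuous mass}.
  apply: (@space_integral_continuous R n Omega K Omega_open K_compact KO `[0, T]%classic
    (fun x t => eta x * sabs (u x t)) 0 r) => //; last 2 first.
  - exact: ltW.
  - by move=> t; rewrite /= !in_itv/= => /andP[-> /le_trans]; apply; exact: ltW.
  apply: jointly_continuousM; first exact: jointly_continuous_fst.
  exact: jointly_continuous_comp (@continuous_sabs R) u_C.
have m0 : mass 0 = 0.
  rewrite /mass /space_integral /Rintegral integral0_eq// => x _; congr EFin.
  have [Ox|nOx] := pselect (Omega (vec x)); first by rewrite u_init// sabs0 mulr0.
  by have [-> _] := etaK (contra_not (@KO (vec x)) nOx); rewrite mul0r.
rewrite leNgt; apply/negP => Br.
have [_ cvg0 _] := (continuous_within_itvP _ r0).1 c0r.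
have Br' : 0 < mass r - strip_const * B by rewrite subr_gt0.
have near_small : \forall s \near 0^'+, `|mass 0 - mass s| < mass r - strip_const * B.
  by move/cvgrPdist_lt : cvg0; apply.
have near_lt : \forall s \near (0 : R)^'+, 0 < s < r.
  near=> s; apply/andP; split; near: s.
    exact: nbhs_right_gt.
  exact: nbhs_right_lt.
have [s [small srs]] : exists s, `|mass 0 - mass s| < mass r - strip_const * B /\ 0 < s < r.
  by apply: (@filter_ex _ (0 : R)^'+); exact: filterI.
have /andP[s0 sr] := srs.
have := mass_increment s0 sr rT; move: small; rewrite m0 sub0r normrN.
by move=> /(le_lt_trans (ler_norm _)); lra.
Unshelve. all: by end_near. Qed.

End WithCutoff.
End Energy.

(** * Uniqueness *)

Lemma exists_powR_small (R : realType) (e0 mu k d : R) :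
  0 < e0 -> 0 < mu -> 0 <= k -> 0 < d ->
  exists2 eps : R, 0 < eps < e0 & k * eps `^ mu < d.
Proof.
move=> e00 mu0 k0 d0; pose y := d / (k + 1).
have k1 : 0 < k + 1 by rewrite ltr_wpDl.
have y0 : 0 < y by rewrite divr_gt0.
have yp : 0 < y `^ mu^-1 by exact: powR_gt0.
pose eps := Num.min (e0 / 2) (y `^ mu^-1).
have eps0 : 0 < eps by rewrite lt_min yp divr_gt0.
exists eps.
  rewrite eps0/=; apply: (@le_lt_trans _ _ (e0 / 2)); first by rewrite ge_min lexx.
  by rewrite ltr_pdivrMr// ltr_pMr// ltr1n.
have epsy : eps `^ mu <= y.
  have -> : y = (y `^ mu^-1) `^ mu by rewrite -powRrM mulVf ?gt_eqF// powRr1// ltW.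
  by rewrite ge0_ler_powR ?nnegrE ?(ltW mu0) ?(ltW eps0) ?(ltW yp)// ge_min lexx orbT.
apply: (@le_lt_trans _ _ (k * y)); first by rewrite ler_wpM2l.
rewrite /y mulrCA -[ltRHS]mulr1 ltr_pM2l// ltr_pdivrMr// mul1r ltrDl.
exact: ltr01.
Qed.

Theorem theorem2p2 (R : realType) (n : nat) (hn : (0 < n)%N)
  (Omega : set 'rV[R]_n)
  (Omega_open : open Omega) (Omega_bounded : bounded_set Omega)
  (Omega_C3 : submanifold 3 n.-1 (boundary Omega))
  (T : R) (T_gt0 : 0 < T)
  (a : 'rV[R]_n -> R -> R)
  (a_C10 : C10 Omega T a)
  (a_ge0 : forall x t, QT Omega T (x, t) -> 0 <= a x t)
  (a_neq0 : exists (x : 'rV[R]_n) (t : R), QT Omega T (x, t) /\ a x t <> 0)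
  (gamma : R) (gamma_ge1 : 1 <= gamma) (gamma_le2 : gamma <= 2)
  (a_bounds : exists c0 c0' c1 : R,
    [/\ 0 < c0', c0' < c0, 0 < c1 &
    forall x t, QT Omega T (x, t) ->
      [/\ c0' * bdist Omega x `^ gamma <= a x t,
          a x t <= c0 * bdist Omega x `^ gamma &
          enorm (grad (a ^~ t) x) <= c1 * bdist Omega x `^ (gamma - 1)]])
  (u : 'rV[R]_n -> R -> R)
  (u_C21 : C21 Omega T u)
  (u_C : {within Omega `*` `[0, T],
    continuous (fun p : 'rV[R]_n * R => u p.1 p.2)})
  (u_eq : forall x t, QT Omega T (x, t) ->
    time_deriv T (u x) t =
    divergence (fun y => a y t *: grad (u ^~ t) y) x)
  (u_init : forall x, Omega x -> u x 0 = 0)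
  (u_growth : exists C eps0 mu : R,
    [/\ 0 < C, 0 < eps0, - 2 * gamma + 4 < mu &
    forall eps : R, 0 < eps -> eps < eps0 ->
      (\int[lebesgue_measure]_(t in `[0%R, T])
         integral_n (inner Omega (eps / 2) `\` inner Omega (2 / 3 * eps))
           (fun x => (`|u x t| * bdist Omega x `^ (gamma - 2))%:E)
       <= (C * eps `^ mu)%:E)%E]) :
  forall x t, QT Omega T (x, t) -> u x t = 0.
Proof.
have [z [tz [[/= Oz _] _]]] := a_neq0.
have bd := boundary_neq0 Omega_open hn Omega_bounded Oz.
have [c0 [c0' [c1 [c0'0 c0c c10 aB]]]] := a_bounds.
have c0_ge0 : 0 <= c0 by rewrite ltW// (lt_trans c0'0).
have a_le x t : QT Omega T (x, t) -> a x t <= c0 * bdist Omega x `^ gamma.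
  by move=> /aB[].
have ga_le x t : QT Omega T (x, t) ->
    enorm (grad (a ^~ t) x) <= c1 * bdist Omega x `^ (gamma - 1).
  by move=> /aB[].
have [Cu [eps0 [mu [Cu0 eps00 muB uB]]]] := u_growth.
have mu0 : 0 < mu by lra.
have [C [C0 cut]] := cutoff_exists hn Omega_open Omega_bounded bd.
have cut_u : jointly_continuous Omega `]0, T] u by case: u_C21 => -[].
have early x t : Omega x -> t \in `]0, T[ -> u x t = 0.
  move=> Ox tT; apply: contrapT => uxt.
  have Jt : `]0, T]%classic t by exact: subset_itv_oo_oc tT.
  pose v := sabs (u x t).
  have v0 : 0 < v.
    rewrite lt_neqAle sabs_ge0 andbT eq_sym; apply/eqP => /sabs_eq0; exact: uxt.
  pose d := bdist Omega x.
  have d0 : 0 < d by exact: bdist_gt0.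
  have : {for x, continuous (fun y => sabs (u y t))}.
    have := jointly_continuous_space (jointly_continuous_comp (@continuous_sabs R) cut_u) Jt.
    by rewrite continuous_open_subspace// => /(_ x); rewrite inE; exact.
  move=> /cvgrPdist_le /(_ (v / 2)); rewrite divr_gt0// => /(_ isT).
  move=> /nbhs_ballP[r /= r0 rv].
  (* The cube of half-side [r'] around [x] is chosen before [eps], so that [delta]
     does not depend on [eps]. *)
  pose r' := Num.min (r / 2) (d / (4 * n%:R)).
  have n0 : 0 < n%:R :> R by rewrite ltr0n.
  have r'0 : 0 < r' by rewrite lt_min !divr_gt0// mulr_gt0.
  have near_x y : `|y - x| <= r' -> [/\ Omega y, d / 2 < bdist Omega y & v / 2 <= sabs (u y t)].
    move=> yr; have yd : enorm (x - y) <= d / 4.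
      rewrite enormB (le_trans (enorm_le_norm _))//.
      apply: (@le_trans _ _ (n%:R * (d / (4 * n%:R)))).
        by rewrite ler_wpM2l ?(ltW n0)// (le_trans yr)// ge_min lexx orbT.
      by rewrite le_eqVlt; apply/orP; left; apply/eqP; field; rewrite gt_eqF.
    split.
    - apply: (ball_bdist Omega_open Ox); rewrite enormB -/d; lra.
    - have := bdist_lipschitz bd x y; rewrite -/d; lra.
    - have : ball x r y.
        rewrite -ball_normE /= distrC (le_lt_trans yr)//.
        rewrite (@le_lt_trans _ _ (r / 2)) ?ge_min ?lexx//.
        by rewrite ltr_pdivrMr// ltr_pMr// ltr1n.
      by move=> /rv; rewrite -/v ler_distl; lra.
  pose delta := v / 2 * (2 * r') ^+ n.
  have delta0 : 0 < delta by rewrite mulr_gt0 ?divr_gt0// exprn_gt0// mulr_gt0.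
  have e1 : 0 < Num.min eps0 (d / 2) by rewrite lt_min eps00 divr_gt0.
  have k0 : 0 <= strip_const n c0 c1 C * Cu.
    by rewrite mulr_ge0// ltW// strip_const_gt0// ltW.
  have [eps /andP[epsp]] := exists_powR_small e1 mu0 k0 delta0.
  rewrite lt_min => /andP[eps_lt epsd] small.
  have [eta [eta1 [eta2 etaP]]] := cut _ epsp.
  have [t0 tltT] : 0 < t /\ t < T by move: tT; rewrite in_itv/= => /andP[].
  have up := mass_le Omega_open Omega_bounded bd a_C10 a_ge0 c0_ge0 (ltW c10) a_le
    ga_le u_C21 u_C u_eq u_init epsp C0 etaP (uB _ epsp eps_lt) t0 tltT.
  have lo : delta <= mass u eta t.
    apply: (mass_ge Omega_open Omega_bounded bd u_C21 epsp etaP Jt _ r'0).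
      by rewrite divr_ge0// ltW.
    move=> y /near_x[Oy dy vy]; split => //; split => //; apply: lt_trans dy; lra.
  by have := le_trans lo up; rewrite mulrA leNgt small.
move=> x t [/= Ox]; rewrite in_itv/= => /andP[t0].
rewrite le_eqVlt => /orP[/eqP ->|tT]; last by apply: early => //; rewrite in_itv/= t0.
(* The final time follows from the earlier ones by continuity. *)
have ux : {within `[0, T], continuous (u x)} by exact: jointly_continuous_time u_C Ox.
have [_ _ cT] := (continuous_within_itvP _ T_gt0).1 ux.
have : u x s @[s --> T^'-] --> 0.
  apply: cvg_near_cst; near=> s; apply: early => //; rewrite in_itv/=.
  apply/andP; split; near: s; [exact: nbhs_left_gt|exact: nbhs_left_lt].
by move=> /(cvg_unique _ cT) <-.
Unshelve. all: by end_near. Qed.
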